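(* Let $\Omega$ be a bounded domain of $\mathbb{R}^d$, let $1<q<\infty$ and $0<\theta\le1$. Let $u_0\in\mathcal{X}_\theta(\Omega)\cap L^q(\Omega)$, $u_0\not\equiv0$, satisfy $|u_0|^{q-2}u_0\in L^{(2_\theta^* )'}(\Omega)$ if $q>2_\theta^*$, and let $u=u(x,t)$ be the energy solution to the Cauchy--Dirichlet problem (CD) (see context) with the initial datum $\rho_0:=|u_0|^{q-2}u_0$. Define the Rayleigh quotient by $$R(w):=\frac{\|w\|_{\mathcal{X}_\theta(\Omega)}^2}{\|w\|_{L^q(\Omega)}^2}\quad\text{for } w\in(\mathcal{X}_\theta(\Omega)\cap L^q(\Omega))\setminus\{0\}.$$ Then the function $t\mapsto R(u(t))$ is nonincreasing as far as $u(t)\neq0$.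
   Context: Function spaces. For $\theta\in(0,1)$, $[w]_{H^\theta(\mathbb{R}^d)}^2:=\frac12\iint_{\mathbb{R}^d\times\mathbb{R}^d}\frac{|w(x)-w(y)|^2}{|x-y|^{d+2\theta}}\,dx\,dy$, $H^\theta(\mathbb{R}^d):=\{w\in L^2(\mathbb{R}^d):[w]_{H^\theta(\mathbb{R}^d)}<\infty\}$, and $\mathcal{X}_\theta(\Omega):=\{w\in H^\theta(\mathbb{R}^d): w=0 \text{ a.e. on }\mathbb{R}^d\setminus\Omega\}$ with norm $\|w\|_{\mathcal{X}_\theta(\Omega)}:=[w]_{H^\theta(\mathbb{R}^d)}$ and the corresponding inner product $(v,w)_{\mathcal{X}_\theta(\Omega)}=\frac12\iint\frac{(v(x)-v(y))(w(x)-w(y))}{|x-y|^{d+2\theta}}\,dx\,dy$. For $\theta=1$, $\mathcal{X}_1(\Omega):=H^1_0(\Omega)$ with $(v,w)_{\mathcal{X}_1(\Omega)}=\int_\Omega\nabla v\cdot\nabla w\,dx$ and the associated norm. The dual is $\mathcal{X}_\theta(\Omega)^*$, with pairing $\langle\cdot,\cdot\rangle_{\mathcal{X}_\theta(\Omega)}$ and pivot space $L^2(\Omega)$. Functions on $\Omega$ are identified with their zero extensions. $(-\Delta)^\theta:\mathcal{X}_\theta(\Omega)\to\mathcal{X}_\theta(\Omega)^*$ is the Riesz map. $2_\theta^*:=2d/(d-2\theta)$ if $d>2\theta$, $2_\theta^*:=\infty$ otherwise; $p':=p/(p-1)$. $C_{\rm weak}(I;X)$ and $C_+(I;X)$ denote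 weakly continuous and strongly right-continuous $X$-valued functions on $I$. $Q_T:=\Omega\times(0,T)$; $u(t):=u(\cdot,t)$. Problem (CD): $\partial_t(|u|^{q-2}u)+(-\Delta)^\theta u=0$ in $\Omega\times(0,\infty)$, $u=0$ on $(\mathbb{R}^d\setminus\Omega)\times(0,\infty)$ (on $\partial\Omega\times(0,\infty)$ if $\theta=1$), $(|u|^{q-2}u)(\cdot,0)=\rho_0$ in $\Omega$. Weak solution on $[0,T]$, $T<\infty$: a pair $(u,\rho)$ of measurable functions on $\mathbb{R}^d\times(0,T)$ such that (1) for any $\varepsilon\in(0,T)$, $u\in L^2(\varepsilon,T;\mathcal{X}_\theta(\Omega))\cap L^q(Q_T)$, $\rho\in C([0,T];\mathcal{X}_\theta(\Omega)^* )\cap W^{1,2}(\varepsilon,T;\mathcal{X}_\theta(\Omega)^* )\cap L^{q'}(Q_T)$; (2) $\rho=|u|^{q-2}u$ a.e. in $Q_T$ and $\langle\partial_t\rho(t),w\rangle_{\mathcal{X}_\theta(\Omega)}+(u(t),w)_{\mathcal{X}_\theta(\Omega)}=0$ for all $w\in\mathcal{X}_\theta(\Omega)$ and a.e. $t\in(0,T)$; (3) $\rho(t)\to\rho_0$ strongly in $\mathcal{X}_\theta(\Omega)^*$ as $t\to0_+$. A weak solution (on $[0,\infty)$) is a weak solution on $[0,S]$ for all $0<S<\infty$; $\rho$ is written $|u|^{q-2}u$. Energy solution: for $u_0\in\mathcal{X}_\theta(\Omega)\cap L^q(\Omega)$ (with $|u_0|^{q-2}u_0\in L^{(2_\theta^*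 )'}(\Omega)$ if $q>2_\theta^*$) and $\rho_0=|u_0|^{q-2}u_0$, (CD) has a unique weak solution $u$; it satisfies $u\in C_{\rm weak}([0,\infty);\mathcal{X}_\theta(\Omega))\cap C_+([0,\infty);\mathcal{X}_\theta(\Omega))\cap C([0,\infty);L^q(\Omega))\cap L^q(\Omega\times(0,\infty))$, $u(0)=u_0$, $|u|^{q-2}u\in C([0,\infty);L^{q'}(\Omega))$, $\partial_t(|u|^{q-2}u)\in C_{\rm weak}([0,\infty);\mathcal{X}_\theta(\Omega)^* )\cap C_+([0,\infty);\mathcal{X}_\theta(\Omega)^* )$, $|u|^{(q-2)/2}u\in W^{1,2}(0,\infty;L^2(\Omega))$; $t\mapsto\|u(t)\|_{L^q(\Omega)}^q$ is absolutely continuous on $[0,\infty)$ with $\frac1{q'}\frac{d}{dt}\|u(t)\|_{L^q(\Omega)}^q+\|u(t)\|_{\mathcal{X}_\theta(\Omega)}^2=0$ for a.e. $t>0$; and $\frac4{qq'}\int_s^t\|\partial_t(|u|^{(q-2)/2}u)(r)\|_{L^2(\Omega)}^2dr+\frac12\|u(t)\|_{\mathcal{X}_\theta(\Omega)}^2\le\frac12\|u(s)\|_{\mathcal{X}_\theta(\Omega)}^2$ for all $0\le s<t<\infty$. It is called the energy solution. *)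

(* Defs.v *)
From HB Require Import structures.
From mathcomp Require Import all_boot all_order all_algebra.
From mathcomp Require Import all_classical all_reals all_analysis.

Set Implicit Arguments.
Unset Strict Implicit.
Unset Printing Implicit Defensive.
Import Order.TTheory GRing.Theory Num.Theory.
Import numFieldNormedType.Exports.

Local Open Scope classical_set_scope.
Local Open Scope ring_scope.

(* ------------------------------------------------------------------------ *)
(* Lebesgue measure on 'rV[R]_n: Borel sigma-algebra generated by the        *)
(* coordinates, measure obtained by iterating the product with the           *)
(* one-dimensional Lebesgue measure (the unit mass at the point if n = 0).   *)
(* ------------------------------------------------------------------------ *)

Definition rV_coord (R : realType) (n : nat) (i : 'I_n) (x : 'rV[R]_n) :
  measurableTypeR R := x ord0 i.

Definition rV_display : measure_display -> measure_display.
Proof. exact. Qed.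

Section measurable_rV.
Context {R : realType} (n : nat).

Let rV_set0 : g_sigma_preimage (@rV_coord R n) set0.
Proof. exact: sigma_algebra0. Qed.

Let rV_setC A :
  g_sigma_preimage (@rV_coord R n) A -> g_sigma_preimage (@rV_coord R n) (~` A).
Proof. exact: sigma_algebraC. Qed.

Let rV_bigcup (F : _^nat) :
  (forall i, g_sigma_preimage (@rV_coord R n) (F i)) ->
  g_sigma_preimage (@rV_coord R n) (\bigcup_i (F i)).
Proof. exact: sigma_algebra_bigcup. Qed.

HB.instance Definition _ := @isMeasurable.Build
  (rV_display default_measure_display) 'rV[R]_n
  (g_sigma_preimage (@rV_coord R n)) rV_set0 rV_setC rV_bigcup.

End measurable_rV.

Section measurable_fun_rV.
Context {R : realType} d (T : measurableType d).

Lemma measurable_rV_coord n (i : 'I_n) :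
  measurable_fun [set: 'rV[R]_n] (@rV_coord R n i).
Proof.
move=> _ A mA; apply: sub_sigma_algebra.
case: n i => [[] []//|n] i.
rewrite -bigcup_mkord_ord.
exists i; first exact: ltn_ord.
by exists A => //; rewrite inord_val.
Qed.

Lemma measurable_fun_rVP n (f : T -> 'rV[R]_n) :
  (forall i, measurable_fun [set: T] (@rV_coord R n i \o f)) ->
  measurable_fun [set: T] f.
Proof.
move=> mf.
have prefS : g_sigma_preimage (fun i => @rV_coord R n i \o f) `<=` measurable.
  apply: smallest_sub; first exact: sigma_algebra_measurable.
  case: n f mf => [|n] f mf; first by rewrite big_ord0.
  rewrite -bigcup_mkord_ord; apply: bigcup_sub => i Ii.
  by move=> A [B mB <-]; exact: mf.
by move=> _ A mA; apply: prefS; rewrite g_sigma_preimage_comp; exists A.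
Qed.

End measurable_fun_rV.

Section rV_cons.
Context {R : realType} (n : nat).

Definition rV_cons (z : measurableTypeR R * 'rV[R]_n) : 'rV[R]_n.+1 :=
  \row_i (if unlift ord0 i is Some j then z.2 ord0 j else z.1).

Definition rV_uncons (x : 'rV[R]_n.+1) : measurableTypeR R * 'rV[R]_n :=
  (x ord0 ord0, \row_j x ord0 (lift ord0 j)).

Lemma rV_consK : cancel rV_cons rV_uncons.
Proof.
move=> [a x]; congr pair; first by rewrite mxE unlift_none.
by apply/rowP => j; rewrite !mxE liftK.
Qed.

Lemma rV_unconsK : cancel rV_uncons rV_cons.
Proof.
move=> x; apply/rowP => i; rewrite !mxE.
by case: unliftP => [j|] ->//=; rewrite mxE.
Qed.

Lemma measurable_rV_cons : measurable_fun setT rV_cons.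
Proof.
apply: measurable_fun_rVP => i.
case: (unliftP ord0 i) => [j|] ij.
  rewrite (_ : _ \o _ = @rV_coord R n j \o snd).
    by apply: measurableT_comp; [exact: measurable_rV_coord|].
  by apply/funext => z /=; rewrite /rV_coord mxE ij liftK.
rewrite (_ : _ \o _ = fst); first exact: measurable_fst.
by apply/funext => z /=; rewrite /rV_coord mxE ij unlift_none.
Qed.

Lemma measurable_rV_uncons : measurable_fun setT rV_uncons.
Proof.
apply/measurable_fun_pairP; split; first exact: measurable_rV_coord.
apply: measurable_fun_rVP => j.
rewrite (_ : _ \o _ = @rV_coord R n.+1 (lift ord0 j)).
  exact: measurable_rV_coord.
by apply/funext => x /=; rewrite /rV_coord mxE.
Qed.

Variable m : {sigma_finite_measure set 'rV[R]_n -> \bar R}.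

Definition rV_lebesgue_step : set 'rV[R]_n.+1 -> \bar R :=
  pushforward (@lebesgue_measure R \x m)%E rV_cons.


Let step0 : rV_lebesgue_step set0 = 0%E.
Proof. by rewrite /rV_lebesgue_step /pushforward preimage_set0 measure0. Qed.

Let step_ge0 A : (0 <= rV_lebesgue_step A)%E.
Proof. by rewrite /rV_lebesgue_step /pushforward measure_ge0. Qed.

Let step_sigma_additive : semi_sigma_additive rV_lebesgue_step.
Proof.
have mpre A : measurable A -> measurable (rV_cons @^-1` A).
  by move=> mA; rewrite -[X in measurable X]setTI; exact: measurable_rV_cons.
move=> F mF tF mUF; rewrite /rV_lebesgue_step /pushforward preimage_bigcup.
apply: measure_semi_sigma_additive.
- by move=> k; exact: mpre.
- apply/trivIsetP => /= i j _ _ ij; rewrite -preimage_setI.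
  by move/trivIsetP : tF => /(_ _ _ _ _ ij) ->//; rewrite preimage_set0.
- by rewrite -preimage_bigcup; exact: mpre.
Qed.

HB.instance Definition _ := isMeasure.Build _ _ _ rV_lebesgue_step
  step0 step_ge0 step_sigma_additive.

Let step_sigma_finite : sigma_finite setT rV_lebesgue_step.
Proof.
have /sigma_finiteP[F [TF ndF Foo]] := sigma_finiteT (@lebesgue_measure R).
have /sigma_finiteP[G [TG ndG Goo]] := sigma_finiteT m.
exists (fun k => rV_uncons @^-1` (F k `*` G k)).
  rewrite -preimage_bigcup (_ : \bigcup_k (F k `*` G k) = setT) //.
  rewrite -setXTT TF TG predeqE => -[x y]; split; last first.
    move=> [/= [k _ Fkx] [l _ Gly]]; exists (maxn k l) => //; split.
    - by move: x Fkx; exact/subsetPset/ndF/leq_maxl.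
    - by move: y Gly; exact/subsetPset/ndG/leq_maxr.
  by move=> [k _ []/= ? ?]; split; exists k.
move=> k; have [mF Fk] := Foo k; have [mG Gk] := Goo k; split.
  rewrite -[X in measurable X]setTI; apply: measurable_rV_uncons => //.
  exact: measurableX.
rewrite /rV_lebesgue_step /pushforward -comp_preimage.
rewrite (_ : rV_uncons \o rV_cons = id); last exact/funext/rV_consK.
by rewrite preimage_id product_measure1E// lte_mul_pinfty// ge0_fin_numE.
Qed.

HB.instance Definition _ := Measure_isSigmaFinite.Build _ _ _ rV_lebesgue_step
  step_sigma_finite.

End rV_cons.

Fixpoint rV_lebesgue (R : realType) (n : nat) :
    {sigma_finite_measure set 'rV[R]_n -> \bar R} :=
  if n is n'.+1 then rV_lebesgue_step (rV_lebesgue R n') else \d_(0 : 'rV[R]_0).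

Lemma rV_lebesgue_box (R : realType) (n : nat)
    (A : 'I_n -> set (measurableTypeR R)) :
  (forall i, measurable (A i)) ->
  measurable [set x : 'rV[R]_n | forall i, A i (rV_coord i x)] /\
  rV_lebesgue R n [set x | forall i, A i (rV_coord i x)] =
    (\prod_i lebesgue_measure (A i))%E.
Proof.
move=> mA; have mB k (B : 'I_k -> set (measurableTypeR R)) :
    (forall i, measurable (B i)) ->
    measurable [set x : 'rV[R]_k | forall i, B i (rV_coord i x)].
  move=> mB; rewrite (_ : [set _ | _] =
      \bigcap_(i in [set: 'I_k]) (@rV_coord R k i @^-1` B i)).
    apply: fin_bigcap_measurable => // i _.
    by rewrite -[X in measurable X]setTI; exact: measurable_rV_coord.
  by apply/seteqP; split => x Bx i => [_|]; exact: Bx.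
split; first exact: mB.
elim: n => [|n IH] in A mA *.
  rewrite big_ord0 /= diracE mem_set //=; by case.
rewrite big_ord_recl -IH; last by move=> i; exact: mA.
rewrite /= /rV_lebesgue_step /pushforward -product_measure1E //; last first.
  exact: (mB n (fun i => A (lift ord0 i))).
congr (_ _); apply/seteqP; split => -[a x] /=.
  move=> H; split; first by have := H ord0; rewrite /rV_coord mxE unlift_none.
  by move=> i; have := H (lift ord0 i); rewrite /rV_coord mxE liftK.
move=> [Aa Ax] i; rewrite /rV_coord mxE.
by case: (unliftP ord0 i) => [j|] -> //=; exact: Ax.
Qed.

Definition partial (R : realType) (n : nat) (i : 'I_n) (f : 'rV[R]_n -> R) :
  'rV[R]_n -> R := fun x => 'D_(delta_mx ord0 i) f x.

Definition smooth_rV (R : realType) (n : nat) (f : 'rV[R]_n -> R) : Prop :=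
  forall s : seq 'I_n, let g := foldr (@partial R n) f s in
    continuous g /\ forall i x, derivable g x (delta_mx ord0 i).

Definition smooth_R (R : realType) (f : R -> R) : Prop :=
  forall k x, derivable (derive1n k f) x 1.

Definition compactly_supported_in (R : realType) (V : topologicalType)
    (D : set V) (f : V -> R) : Prop :=
  exists K, [/\ compact K, K `<=` D & forall x, ~ K x -> f x = 0].

Definition test_rV (R : realType) (n : nat) (D : set 'rV[R]_n) : set ('rV[R]_n -> R) :=
  [set f | smooth_rV f /\ compactly_supported_in D f].

Definition test_R (R : realType) (I : set R) : set (R -> R) :=
  [set f | smooth_R f /\ compactly_supported_in I f].

Definition eucl_norm (R : realType) (n : nat) (x : 'rV[R]_n) : R :=
  Num.sqrt (\sum_i x ord0 i ^+ 2).

Definition bounded_domain (R : realType) (n : nat) (D : set 'rV[R]_n) : Prop :=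
  [/\ open D, connected D, bounded_set D & D !=set0].

Definition weak_deriv (R : realType) (I : set R) (f g : R -> R) : Prop :=
  forall phi, test_R I phi ->
    \int[lebesgue_measure]_(t in I) (derive1 phi t * f t) =
    - \int[lebesgue_measure]_(t in I) (phi t * g t).

Definition abs_continuous_on (R : realType) (I : set R) (F : R -> R) : Prop :=
  forall eps : R, 0 < eps -> exists2 delta : R, 0 < delta &
    forall (k : nat) (a b : 'I_k -> R),
      (forall i, [/\ I (a i), I (b i) & a i <= b i]) ->
      trivIset setT (fun i => `]a i, b i[%classic) ->
      \sum_i (b i - a i) < delta -> \sum_i `|F (b i) - F (a i)| < eps.

(* Continuity of a curve with values in functions T -> R, the distance of two *)
(* of which is measured by N applied to their difference.                     *)
Definition strong_cont (R : realType) (T : Type) (I : set R)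
    (N : (T -> R) -> \bar R) (f : R -> (T -> R)) : Prop :=
  forall t, I t -> N (f s \- f t) @[s --> within I (nbhs t)] --> 0%E.

Definition strong_right_cont (R : realType) (T : Type) (I : set R)
    (N : (T -> R) -> \bar R) (f : R -> (T -> R)) : Prop :=
  forall t, I t -> N (f s \- f t) @[s --> t^'+] --> 0%E.

(* |x|^r x, so that |w|^{q-2} w is spow (q - 2) \o w; its value at x = 0 is 0 *)
Definition spow (R : realType) (r x : R) : R := `|x| `^ r * x.

(* the critical Sobolev exponent 2^*_th *)
Definition crit_exp (R : realType) (d : nat) (th : R) : \bar R :=
  if 2 * th < d%:R then (2 * d%:R / (d%:R - 2 * th))%:E else +oo%E.

(* Functions on D are identified with their zero extensions, so everything is *)
(* stated for functions on the whole space; they are not quotiented by a.e.   *)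
(* equality, which is handled by ae_zero.                                     *)

Section function_spaces.
Context {R : realType} {d : nat}.
Local Notation E := 'rV[R]_d.
Local Notation mu := (rV_lebesgue R d).
Local Notation leb := (@lebesgue_measure R).
Implicit Types (D : set E) (th : R) (p : \bar R) (v w : E -> R).

Definition ae_zero (w : E -> R) : Prop := {ae mu, forall x, w x = 0}.

Definition ae_zero_off D w : Prop := {ae mu, forall x, ~ D x -> w x = 0}.

Definition Lp_norm D p w : \bar R := ('N[mu]_p [EFin \o (w \_ D)])%E.

Definition in_Lp D p w : Prop :=
  measurable_fun D w /\ (Lp_norm D p w < +oo)%E.

Definition Lp_normR D p w : R := fine (Lp_norm D p w).

Definition gagliardo_sq th w : \bar R :=
  ((2^-1)%:E * \int[mu \x mu]_z
     ((w z.1 - w z.2) ^+ 2 / eucl_norm (z.1 - z.2) `^ (d%:R + 2 * th))%:E)%E.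

Definition in_Hfrac th w : Prop :=
  [/\ measurable_fun setT w, in_Lp setT 2%:E w & (gagliardo_sq th w < +oo)%E].

Definition frac_inner th v w : R :=
  2^-1 * \int[(mu \x mu)%E]_z
     ((v z.1 - v z.2) * (w z.1 - w z.2) /
        eucl_norm (z.1 - z.2) `^ (d%:R + 2 * th)).

Definition is_weak_partial D (i : 'I_d) w g : Prop :=
  forall phi, test_rV D phi ->
    \int[mu]_(x in D) (w x * partial i phi x) =
    - \int[mu]_(x in D) (g x * phi x).

Definition in_H1 D w : Prop :=
  in_Lp D 2%:E w /\
  forall i, exists g, in_Lp D 2%:E g /\ is_weak_partial D i w g.

Definition weak_partial D (i : 'I_d) w : E -> R :=
  xget (fun=> 0) [set g | in_Lp D 2%:E g /\ is_weak_partial D i w g].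

(* closure of the test functions in H^1(D) *)
Definition in_H10 D w : Prop :=
  in_H1 D w /\
  exists phi : nat -> E -> R,
    [/\ forall n, test_rV D (phi n),
        Lp_norm D 2%:E (w \- phi n) @[n --> \oo] --> 0%E &
        forall i, Lp_norm D 2%:E (weak_partial D i w \- partial i (phi n))
                    @[n --> \oo] --> 0%E].

Definition grad_inner D v w : R :=
  \int[mu]_(x in D) (\sum_i weak_partial D i v x * weak_partial D i w x).

Definition in_X D th w : Prop :=
  [/\ measurable_fun setT w, ae_zero_off D w &
      if th == 1 then in_H10 D w else in_Hfrac th w].

Definition X_inner D th v w : R :=
  if th == 1 then grad_inner D v w else frac_inner th v w.

Definition X_norm D th w : R := Num.sqrt (X_inner D th w w).

Definition X_normE D th w : \bar R := (X_norm D th w)%:E.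

(* A functional on X is a map on all functions, of which only the restriction *)
(* to X is meaningful.                                                        *)
Definition Xdual_norm D th (l : (E -> R) -> R) : \bar R :=
  ereal_sup [set (`|l w|)%:E | w in [set w | in_X D th w /\ X_norm D th w <= 1]].

Definition in_Xdual D th (l : (E -> R) -> R) : Prop :=
  (forall a v w, in_X D th v -> in_X D th w ->
     l (fun x => a * v x + w x) = a * l v + l w) /\
  (Xdual_norm D th l < +oo)%E.

(* Identification of f in L^{q'}(D) with l in the dual of X, L^2(D) being the *)
(* pivot space: X `&` L^q(D) is dense in X, so f determines l.                *)
Definition represents D th (q : R) (f : E -> R) (l : (E -> R) -> R) : Prop :=
  [/\ in_Lp D (hoelder_conjugate q%:E) f, in_Xdual D th l &
      forall w, in_X D th w -> in_Lp D q%:E w ->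
        l w = \int[mu]_(x in D) (f x * w x)].

Definition meas_xt (I : set R) D (u : R -> E -> R) : Prop :=
  measurable_fun ((I : set (measurableTypeR R)) `*` D)
    (fun z : measurableTypeR R * E => u z.1 z.2).

Definition in_Lp_xt (I : set R) D (p : R) (u : R -> E -> R) : Prop :=
  meas_xt I D u /\
  (\int[leb \x mu]_(z in (I : set (measurableTypeR R)) `*` D)
      (`|u z.1 z.2| `^ p)%:E < +oo)%E.

(* L^2(I; X): measurability is weak measurability, X being separable *)
Definition in_L2_X (I : set R) D th (u : R -> E -> R) : Prop :=
  exists u' : R -> E -> R,
    [/\ forall t, I t -> in_X D th (u' t),
        forall l, in_Xdual D th l ->
          measurable_fun (I : set (measurableTypeR R)) (fun t => l (u' t)),
        (\int[leb]_(t in I) (X_norm D th (u' t) ^+ 2)%:E < +oo)%E &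
        {ae leb, forall t, I t -> ae_zero (u t \- u' t)}].

Definition in_L2_Xdual (I : set R) D th (r : R -> (E -> R) -> R) : Prop :=
  [/\ forall t, I t -> in_Xdual D th (r t),
      forall w, in_X D th w ->
        measurable_fun (I : set (measurableTypeR R)) (fun t => r t w) &
      (\int[leb]_(t in I) (Xdual_norm D th (r t) ^+ 2) < +oo)%E].

(* The X^*-valued integrals of the weak derivative are tested against w in X. *)
Definition weak_deriv_Xdual (I : set R) D th (r s : R -> (E -> R) -> R) : Prop :=
  forall w, in_X D th w -> weak_deriv I (fun t => r t w) (fun t => s t w).

(* v in W^{1,2}(I; L^2(D)) with derivative dv; L^2(I; L^2(D)) is L^2(I x D) and *)
(* the L^2(D)-valued integrals of the weak derivative are tested against w.     *)
Definition W12_L2 (I : set R) D (v dv : R -> E -> R) : Prop :=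
  [/\ in_Lp_xt I D 2 v, in_Lp_xt I D 2 dv &
      forall w, in_Lp D 2%:E w ->
        weak_deriv I (fun t => \int[mu]_(x in D) (v t x * w x))
                     (fun t => \int[mu]_(x in D) (dv t x * w x))].

Definition weak_cont_X (I : set R) D th (u : R -> E -> R) : Prop :=
  forall l, in_Xdual D th l -> {within I, continuous (fun t => l (u t))}.

(* X is reflexive, so weak continuity in the dual is tested on X *)
Definition weak_cont_Xdual (I : set R) D th (s : R -> (E -> R) -> R) : Prop :=
  forall w, in_X D th w -> {within I, continuous (fun t => s t w)}.

(* r is the representative of rho in C([0,T]; X^* ), s the time derivative of *)
(* rho, and l0 the initial datum rho0 viewed in X^*.                          *)
Definition weak_solution_on D th (q T : R) (u rho : R -> E -> R)
    (rho0 : E -> R) : Prop :=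
  meas_xt `]0, T[ setT u /\ meas_xt `]0, T[ setT rho /\
  (forall eps, 0 < eps < T -> in_L2_X `]eps, T[ D th u) /\
  in_Lp_xt `]0, T[ D q u /\ in_Lp_xt `]0, T[ D (q / (q - 1)) rho /\
  exists r s : R -> (E -> R) -> R,
    [/\ (forall t, 0 <= t <= T -> in_Xdual D th (r t)) /\
          strong_cont `[0, T] (Xdual_norm D th) r,
        {ae leb, forall t, 0 < t < T -> represents D th q (rho t) (r t)},
        forall eps, 0 < eps < T ->
          [/\ in_L2_Xdual `]eps, T[ D th r, in_L2_Xdual `]eps, T[ D th s &
              weak_deriv_Xdual `]eps, T[ D th r s],
        {ae (leb \x mu)%E, forall z, 0 < z.1 < T -> D z.2 ->
           rho z.1 z.2 = spow (q - 2) (u z.1 z.2)} /\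
        {ae leb, forall t, 0 < t < T ->
           forall w, in_X D th w -> s t w + X_inner D th (u t) w = 0} &
        exists l0, represents D th q rho0 l0 /\
          Xdual_norm D th (r t \- l0) @[t --> 0^'+] --> 0%E].

Definition weak_solution D th (q : R) (u : R -> E -> R) (rho0 : E -> R) : Prop :=
  forall S : R, 0 < S ->
    weak_solution_on D th q S u (fun t => spow (q - 2) \o u t) rho0.

Record energy_solution D th (q : R) (u0 : E -> R) (u : R -> E -> R) : Prop := {
  es_weak : weak_solution D th q u (spow (q - 2) \o u0);

  es_init : ae_zero (u 0 \- u0);
  es_space : forall t, 0 <= t -> in_X D th (u t) /\ in_Lp D q%:E (u t);
  es_weak_cont : weak_cont_X `[0, +oo[ D th u;
  es_right_cont : strong_right_cont `[0, +oo[ (X_normE D th) u;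
  es_Lq_cont : strong_cont `[0, +oo[ (Lp_norm D q%:E) u;
  es_Lq_xt : in_Lp_xt `]0, +oo[ D q u;

  es_rho_cont :
    (forall t, 0 <= t ->
       in_Lp D (hoelder_conjugate q%:E) (spow (q - 2) \o u t)) /\
    strong_cont `[0, +oo[ (Lp_norm D (hoelder_conjugate q%:E))
      (fun t => spow (q - 2) \o u t);

  (* s is the time derivative of |u|^{q-2} u *)
  es_rho_deriv : exists s : R -> (E -> R) -> R,
    [/\ forall t, 0 <= t -> in_Xdual D th (s t),
        exists r : R -> (E -> R) -> R,
          (forall t, 0 <= t ->
             represents D th q (spow (q - 2) \o u t) (r t)) /\
          weak_deriv_Xdual `]0, +oo[ D th r s,
        weak_cont_Xdual `[0, +oo[ D th s &
        strong_right_cont `[0, +oo[ (Xdual_norm D th) s];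

  es_Lq_abs_cont :
    abs_continuous_on `[0, +oo[ (fun t => Lp_normR D q%:E (u t) `^ q);
  es_Lq_identity : {ae leb, forall t, 0 < t ->
    let F := fun t => Lp_normR D q%:E (u t) `^ q in
    derivable F t 1 /\
    (q / (q - 1))^-1 * derive1 F t + X_norm D th (u t) ^+ 2 = 0};

  (* dv is the time derivative of |u|^{(q-2)/2} u *)
  es_dissipation : exists dv : R -> E -> R,
    W12_L2 `]0, +oo[ D (fun t => spow ((q - 2) / 2) \o u t) dv /\
    forall s t, 0 <= s -> s < t ->
      ((4 / (q * (q / (q - 1))))%:E *
         \int[leb]_(r in `]s, t[) (Lp_norm D 2%:E (dv r) ^+ 2)
       + (2^-1 * X_norm D th (u t) ^+ 2)%:E
       <= (2^-1 * X_norm D th (u s) ^+ 2)%:E)%E }.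

Definition rayleigh D th (q : R) w : R :=
  X_norm D th w ^+ 2 / Lp_normR D q%:E w ^+ 2.

End function_spaces.

(* Main.v *)
Require Import Defs.
From mathcomp Require Import all_boot all_order all_algebra.
From mathcomp Require Import all_classical all_reals all_analysis.
From mathcomp Require Import measurable_realfun ring lra.
Import Order.TTheory GRing.Theory Num.Theory.
Import numFieldNormedType.Exports.
Local Open Scope classical_set_scope.
Local Open Scope ring_scope.

(** Write F(t) for the q-th power of the L^q norm of u(t), X(t) for the square
    of its norm in the energy space, and k = q / (q - 1).  The quotient is
    X / F^(2/q).  Formally, F' = - k X.  With v = |u|^((q-2)/2) u one has
    F = |v|^2 in L^2, hence F' = 2 (v, v') and, by the Cauchy-Schwarz
    inequality, |v'|^2 >= F'^2 / (4 F) = k^2 X^2 / (4 F); the dissipation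
    inequality then reads X' <= - (2 k / q) X^2 / F, which is exactly what makes
    the derivative of X / F^(2/q) nonpositive.

    The function X is only monotone, so the argument is carried out on
    increments.  For s <= t,

    - k X(t) (t - s) <= F(s) - F(t) <= k X(s) (t - s), because F is absolutely
      continuous (lemma Lq_norm_decrease, based on abs_continuous_ge_deriv);
    - X(s) - X(t) >= (2 k / q) X(t)^2 (t - s) / F(s) (lemma X_norm_decrease).

    For the second bound, |v(t) - v(s)|^2 <= (t - s) times the integral of
    |v'|^2 over ]s, t[ (lemma dissipation_increment).  It is obtained by testing
    the weak derivative v' with a smooth approximation of the indicator of
    ]s, t[ in time and with v(t) - v(s) in space (lemma
    weak_deriv_le_increment); passing to the limit in the test function uses the
    weak continuity of v in L^2 (lemma continuous_v_weak).

    Taking logarithms, the two bounds show that ln X - (2 / q) ln F decreases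
    over [s, t] up to an error C (t - s) (M(s) - M(t)), where M = X^2 F is
    monotone.  Over a partition into n equal intervals the errors add up to
    O(1 / n) (lemma quotient_nonincreasing). *)

Set Implicit Arguments.
Unset Strict Implicit.
Unset Printing Implicit Defensive.

(** * Absolutely continuous functions *)

(** Near a point where the derivative exceeds m, all slopes from that point are
    at least m; multiplying by y - x treats both sides of x at once. *)
Lemma deriv_slope_ge (R : realType) (F : R -> R) (x m : R) :
  derivable F x 1 -> m < derive1 F x ->
  exists2 r : R, 0 < r & forall y, `|y - x| < r ->
    0 <= (y - x) * (F y - F x - m * (y - x)).
Proof.
move=> dF mF.
have /cvgr_gt : (h^-1 *: (F (h *: (1 : R) + x) - F x)) @[h --> 0^'] --> derive1 F x.
  by rewrite derive1E; exact: dF.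
move=> /(_ _ mF); rewrite near_withinE => -[r /= r0 Hr].
exists r => // y yx.
have [->|ynx] := eqVneq y x; first by rewrite subrr mul0r.
have yx0 : y - x != 0 by rewrite subr_eq0.
have := Hr (y - x); rewrite /= sub0r normrN => /(_ yx yx0).
rewrite scaler1 subrK => H.
have -> : (y - x) * (F y - F x - m * (y - x)) =
  (y - x) ^+ 2 * ((y - x)^-1 *: (F y - F x) - m).
  by rewrite -[_ *: _]/(_ * _); field.
by rewrite mulr_ge0 ?sqr_ge0// subr_ge0 ltW.
Qed.

(** Finite families of non-overlapping closed subintervals of [a, c] contained
    in U, given by their pairs of endpoints and listed from right to left. *)
Definition ordered_itvs (R : realType) (U : set R) (a c : R) (s : seq (R * R)) :=
  (forall p, p \in s ->
     [/\ a <= p.1, p.1 <= p.2, p.2 <= c & `[p.1, p.2] `<=` U]) /\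
  pairwise (fun p p' : R * R => p'.2 <= p.1) s.

Lemma ordered_itvs_length (R : realType) (U : set R) (a c : R) s :
  measurable (U : set (measurableTypeR R)) -> ordered_itvs U a c s ->
  ((\sum_(p <- s) (p.2 - p.1))%:E <= lebesgue_measure (U `&` `]-oo, c]))%E.
Proof.
move=> mU; elim: s c => [|p s IH] c [Hs Ps]; first by rewrite big_nil.
have [ap pp pc pU] := Hs p (mem_head _ _).
move: Ps; rewrite pairwise_cons => /andP[/allP Pp Ps].
have Hs' : ordered_itvs U a p.1 s.
  split=> // p' p's; have [] := Hs p' _; first by rewrite inE p's orbT.
  by split=> //; exact: Pp.
rewrite big_cons EFinD.
have -> : (p.2 - p.1)%:E = lebesgue_measure (`]p.1, p.2] : set R).
  rewrite lebesgue_measure_itv/= lte_fin; case: ltP => //.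
  by move=> p21; rewrite (@le_anti _ _ p.1 p.2) ?subrr ?pp.
rewrite addeC; apply: le_trans.
  by apply: leeD; [exact: IH Hs'|exact: lexx].
rewrite -measureU//; last 1 first.
- apply/seteqP; split=> // x [[_]] /=; rewrite !in_itv/= => xp /andP[px _].
  by rewrite ltNge xp in px.
- apply: le_measure; rewrite ?inE//.
  + by apply: measurableU => //; apply: measurableI.
  + by apply: measurableI.
  + move=> x [[Ux]|] /=; rewrite !in_itv/=.
    * by move=> xp; split=> //; exact: le_trans xp (le_trans pp pc).
    * move=> /andP[px xp]; split; last exact: le_trans xp pc.
      by apply: pU; rewrite /= in_itv/= (ltW px).
- by apply: measurableI.
Qed.

Lemma abs_continuous_ordered_itvs (R : realType) (I U : set R) (F : R -> R)
    (a c eps delta : R) s :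
  (forall (k : nat) (a b : 'I_k -> R),
      (forall i, [/\ I (a i), I (b i) & a i <= b i]) ->
      trivIset setT (fun i => `]a i, b i[%classic) ->
      \sum_i (b i - a i) < delta -> \sum_i `|F (b i) - F (a i)| < eps) ->
  (forall x, a <= x <= c -> I x) ->
  measurable (U : set (measurableTypeR R)) ->
  (lebesgue_measure U < delta%:E)%E -> ordered_itvs U a c s ->
  \sum_(p <- s) `|F p.2 - F p.1| < eps.
Proof.
move=> HF HI mU Ud Hs; rewrite (big_nth (0, 0)) big_mkord.
apply: (HF _ (fun i => (nth (0, 0) s i).1) (fun i => (nth (0, 0) s i).2)).
- move=> i; have [] := (Hs.1 (nth (0, 0) s i) (mem_nth _ (ltn_ord i))).
  move=> h1 h2 h3 _; split=> //; apply: HI; apply/andP; split=> //.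
  + exact: le_trans h2 h3.
  + exact: le_trans h1 h2.
- have key (i j : 'I_(size s)) x : (i < j)%N ->
      `](nth (0, 0) s i).1, (nth (0, 0) s i).2[%classic x ->
      `](nth (0, 0) s j).1, (nth (0, 0) s j).2[%classic x -> False.
    move=> ij /=; rewrite !in_itv/= => /andP[h1 _] /andP[_ h2].
    have /(pairwiseP (0, 0)) /(_ i j) := Hs.2.
    rewrite !inE !ltn_ord => /(_ isT isT ij) h3.
    by have := lt_le_trans h2 (le_trans h3 (ltW h1)); rewrite ltxx.
  apply/trivIsetP => i j _ _ ij; apply/seteqP; split=> // x [xi xj].
  move: ij; rewrite -val_eqE neq_ltn => /orP[ij|ij].
  + exact: key ij xi xj.
  + exact: key ij xj xi.
- rewrite -lte_fin; apply: le_lt_trans Ud.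
  have := @ordered_itvs_length _ U a c s mU Hs.
  rewrite (big_nth (0, 0)) big_mkord => /le_trans; apply.
  by apply: le_measure; rewrite ?inE//; exact: measurableI.
Qed.

(** Monotonicity principle for absolutely continuous functions: an almost
    everywhere lower bound on the derivative integrates to a lower bound on the
    increment.  The exceptional set is enclosed in an open set U of small
    measure.  One then walks from a to b by steps on which either the slope is
    at least m - eps, or the interval lies in U; the increments over the steps
    of the second kind are controlled by absolute continuity. *)
Lemma abs_continuous_ge_deriv (R : realType) (I : set R) (F : R -> R)
    (m a b : R) :
  abs_continuous_on I F -> (forall x, a <= x <= b -> I x) -> a <= b ->
  {ae lebesgue_measure, forall x, a < x < b ->
     derivable F x 1 /\ m <= derive1 F x} ->
  m * (b - a) <= F b - F a.
Proof.
move=> acF HI ab [N [mN N0 HN]].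
suff H eps : 0 < eps -> (m - eps) * (b - a) - eps *+ 2 <= F b - F a.
  rewrite leNgt; apply/negP => h.
  pose e := (m * (b - a) - (F b - F a)) / ((b - a + 2) *+ 2).
  have e0 : 0 < e by rewrite divr_gt0 ?subr_gt0 ?pmulrn_lgt0// ltr_wpDl// subr_ge0.
  have := H _ e0.
  have -> : (m - e) * (b - a) - e *+ 2 = m * (b - a) - e * (b - a + 2) by ring.
  have -> : e * (b - a + 2) = (m * (b - a) - (F b - F a)) / 2.
    by rewrite /e; field; rewrite gt_eqF// ltr_wpDl// subr_ge0.
  lra.
move=> eps0; have [delta delta0 Hd] := acF _ eps0.
pose K := `|m - eps|.
have K0 : 0 < K + 1 by rewrite /K ltr_wpDl.
pose eta := Order.min delta (eps / (K + 1)).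
have eta0 : 0 < eta by rewrite lt_min delta0 divr_gt0.
have mN' : measurable ((N `|` [set a; b]) : set (measurableTypeR R)).
  by apply: measurableU => //; apply: measurableU.
have N'0 : lebesgue_measure (N `|` [set a; b]) = 0%E.
  have h1 : lebesgue_measure.-negligible (N `|` [set a; b]).
    apply: negligibleU; last (apply: negligibleU).
    - by apply/negligibleP.
    - by apply/negligibleP => //; exact: lebesgue_measure_set1.
    - by apply/negligibleP => //; exact: lebesgue_measure_set1.
  by apply/negligibleP.
have [|U [oU NU UN']] := @lebesgue_regularity_outer R _ eta mN' _ eta0.
  by rewrite [X in (X < _)%E]N'0.
have mU : measurable (U : set (measurableTypeR R)) by exact: open_measurable.
have Ue : (lebesgue_measure U < eta%:E)%E.
  rewrite -(setDUK NU) measureU//; last 2 first.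
  - exact: measurableD.
  - by apply/seteqP; split=> // x [? []].
  by rewrite /= N'0 add0e.
have Ud : (lebesgue_measure U < delta%:E)%E.
  by apply: lt_le_trans Ue _; rewrite lee_fin ge_min lexx.
(* T y z: the step from y to z is admissible *)
pose T y z := (m - eps) * (z - y) <= F z - F y \/ `[y, z] `<=` U.
have step x : a <= x <= b -> exists2 r : R, 0 < r &
    (forall y, x - r < y <= x -> T y x) /\ (forall z, x <= z < x + r -> T x z).
  move=> /andP[ax xb].
  have [N'x|N'x] := pselect ((N `|` [set a; b]) x).
    have [r /= r0 Hr] : nbhs x U by apply: open_nbhs_nbhs; split=> //; exact: NU.
    exists r => //; split=> y /andP[h1 h2]; right=> z /=; rewrite in_itv/= =>
      /andP[h3 h4]; apply: Hr; rewrite /ball/= ltr_distl; lra.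
  have /andP[xa xb'] : (x != a) && (x != b).
    by apply/andP; split; apply/eqP => xE; apply: N'x; right; rewrite xE /=; [left|right].
  have [dF mF] : derivable F x 1 /\ m <= derive1 F x.
    apply: contrapT => h; apply: N'x; left; apply: HN => /= h'; apply: h; apply: h'.
    by rewrite !lt_neqAle ax xb xb' eq_sym xa.
  have [|r r0 Hr] := @deriv_slope_ge R F x (m - eps) dF _.
    by apply: lt_le_trans mF; rewrite gtrDl oppr_lt0.
  exists r => //; split=> y /andP[h1 h2]; left.
    have [->|yx] := eqVneq y x; first by rewrite !subrr mulr0.
    have : 0 <= (y - x) * (F y - F x - (m - eps) * (y - x)).
      by apply: Hr; rewrite ltr_distl; lra.
    rewrite nmulr_rge0 ?subr_lt0 ?lt_neqAle ?yx//; lra.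
  have [->|yx] := eqVneq y x; first by rewrite !subrr mulr0.
  have : 0 <= (y - x) * (F y - F x - (m - eps) * (y - x)).
    by apply: Hr; rewrite ltr_distl; lra.
  rewrite pmulr_rge0 ?subr_gt0 ?lt_neqAle 1?eq_sym ?yx//; lra.
(* reach c: c can be attained from a, the list s recording the steps inside U *)
pose reach c := a <= c <= b /\ exists s, ordered_itvs U a c s /\
  (m - eps) * (c - a) - \sum_(p <- s) (`|F p.2 - F p.1| + K * (p.2 - p.1)) <= F c - F a.
have reachT y z : reach y -> T y z -> y <= z <= b -> reach z.
  move=> [/andP[ay yb] [s [[Os Ps] Hs]]] Tyz /andP[yz zb].
  split; first by rewrite zb (le_trans ay yz).
  case: Tyz => [H|H].
    exists s; split; last by lra.
    by split=> // p /Os[? ? h ?]; split=> //; exact: le_trans h yz.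
  exists ((y, z) :: s); split; last first.
    rewrite big_cons/=; have := ler_norm (- (F z - F y)); rewrite normrN.
    have : (m - eps) * (z - y) <= K * (z - y) by rewrite ler_wpM2r ?subr_ge0// ler_norm.
    lra.
  split=> [p|].
    rewrite inE => /orP[/eqP ->|/Os[? ? h ?]]; split=> //=; exact: le_trans h yz.
  by rewrite pairwise_cons Ps andbT; apply/allP => p /Os[].
have ra : reach a.
  split; first by rewrite lexx.
  by exists [::]; rewrite big_nil; split=> //; rewrite !subrr mulr0.
(* the supremum of the attainable points is attainable, hence equal to b *)
have supE : has_sup reach.
  by split; [exists a|exists b => c [/andP[]]].
have aS : a <= sup reach by exact: (ub_le_sup supE.2).
have Sb : sup reach <= b by apply: ge_sup; [exists a|move=> c [/andP[]]].
have [|r r0 [Hl Hr]] := step (sup reach); first by rewrite aS Sb.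
have [y ry Sy] := sup_adherent r0 supE.
have yS : y <= sup reach by exact: (ub_le_sup supE.2).
have rS : reach (sup reach).
  by apply: (reachT y) => //; [apply: Hl; rewrite Sy yS|rewrite yS Sb].
have Sb' : sup reach = b.
  apply/eqP; rewrite eq_le Sb leNgt; apply/negP => Sb'.
  pose z := Order.min b (sup reach + r / 2).
  have [zS zS' zb] : [/\ sup reach < z, z < sup reach + r & z <= b].
    by split; rewrite /z ?lt_min ?gt_min ?ge_min ?lexx ?Sb'//=; [lra|apply/orP; right; lra].
  have rz : reach z.
    by apply: (reachT (sup reach)) => //; [apply: Hr|]; rewrite (ltW zS).
  by have := ub_le_sup supE.2 rz; rewrite leNgt zS.
move: rS; rewrite Sb' => -[_ [s [Os Hs]]].
apply: le_trans Hs; rewrite lerB// big_split/= mulr2n lerD//.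
  apply: ltW; exact: (@abs_continuous_ordered_itvs R I U F a b eps delta s).
rewrite -mulr_sumr; apply: (@le_trans _ _ (K * eta)).
  rewrite ler_wpM2l ?normr_ge0// -lee_fin; apply: le_trans (ordered_itvs_length mU Os) _.
  apply: le_trans (ltW Ue); apply: le_measure; rewrite ?inE//; exact: measurableI.
apply: (@le_trans _ _ (K * (eps / (K + 1)))).
  by rewrite ler_wpM2l ?normr_ge0// ge_min lexx orbT.
by rewrite mulrA ler_pdivrMr// [leLHS]mulrC ler_wpM2l ?(ltW eps0)// lerDl.
Qed.

(** * Monotonicity of a quotient from increments *)

(** If decrements of L are bounded below by - C (t - s) (M s - M t), then
    L T <= L S: over n equal steps the error telescopes to
    C (T - S) / n * (M S - M T), which vanishes as n grows. *)
Lemma le_of_small_increments (R : realType) (L M : R -> R) (C S T : R) :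
  S <= T -> 0 <= C ->
  (forall s t, S <= s -> s <= t -> t <= T ->
     - (C * (t - s) * (M s - M t)) <= L s - L t) ->
  L T <= L S.
Proof.
move=> ST C0 H; pose B := C * (T - S) * (M S - M T).
suff HB n : - (B / n.+1%:R) <= L S - L T.
  rewrite -subr_ge0 leNgt; apply/negP => LST.
  have [n Hn] : exists n, B < (L T - L S) * n.+1%:R.
    have LTS : 0 < L T - L S by lra.
    exists (Num.trunc (`|B| / (L T - L S))).
    rewrite -ltr_pdivrMl// mulrC; apply: le_lt_trans (truncnS_gt _).
    by rewrite ler_wpM2r ?invr_ge0 ?(ltW LTS)// ler_norm.
  have := HB n; rewrite lerNl opprB; apply/negP; rewrite -ltNge.
  by rewrite ltr_pdivrMr.
pose h := (T - S) / n.+1%:R.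
have h0 : 0 <= h by rewrite divr_ge0// subr_ge0.
have nh : n.+1%:R * h = T - S by rewrite /h mulrCA divff ?mulr1// pnatr_eq0.
have Hk k : (k <= n.+1)%N ->
    - (C * h * (M S - M (S + k%:R * h))) <= L S - L (S + k%:R * h).
  elim: k => [_|k IH kn]; first by rewrite mul0r addr0 !subrr mulr0 oppr0.
  have kh : S + k.+1%:R * h = S + k%:R * h + h by rewrite -natr1 mulrDl mul1r addrA.
  have h1 : S <= S + k%:R * h by rewrite lerDl mulr_ge0.
  have h2 : S + k%:R * h <= S + k.+1%:R * h by rewrite kh lerDl.
  have h3 : S + k.+1%:R * h <= T.
    by rewrite -[leRHS](subrKC S) -nh lerD2l ler_wpM2r// ler_nat.
  have := H _ _ h1 h2 h3; have := IH (ltnW kn).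
  have -> : S + k.+1%:R * h - (S + k%:R * h) = h by rewrite kh; ring.
  lra.
have := Hk n.+1 (leqnn _); rewrite nh subrKC; apply: le_trans.
by rewrite lerN2 /B /h le_eqVlt; apply/orP; left; apply/eqP; ring.
Qed.

(** One step of length h of the Riemann-sum argument, from the values xs, fs at
    the left endpoint to xt, ft at the right one.  The two logarithmic
    increments cancel up to an error of the form h times the decrement of
    x^2 f. *)
Lemma ln_quotient_step (R : realType) (p k xs xt fs ft h : R) :
  0 < p -> 0 < k -> 0 <= h -> 0 < xt -> xt <= xs -> 0 < ft -> ft <= fs ->
  fs - ft <= k * xs * h -> p * k * xt ^+ 2 * h / fs <= xs - xt ->
  - (p * k * h * (xs ^+ 2 * fs - xt ^+ 2 * ft) / (fs * ft * xs)) <=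
    (ln xs - p * ln fs) - (ln xt - p * ln ft).
Proof.
move=> p0 k0 h0 xt0 xts ft0 fts H1 H2.
have xs0 : 0 < xs by exact: lt_le_trans xts.
have fs0 : 0 < fs by exact: lt_le_trans fts.
have lnle (y : R) : 0 < y -> ln y <= y - 1.
  by move=> y0; have := expR_ge1Dx (ln y); rewrite lnK//; lra.
have h1 : ln xt - ln xs <= xt / xs - 1.
  by rewrite -ln_div// lnle// divr_gt0.
have h2 : ln fs - ln ft <= fs / ft - 1.
  by rewrite -ln_div// lnle// divr_gt0.
have h3 : p * k * xt ^+ 2 * h / (fs * xs) <= 1 - xt / xs.
  rewrite invfM mulrA.
  have -> : 1 - xt / xs = (xs - xt) / xs by rewrite mulrBl divff ?gt_eqF.
  by rewrite ler_wpM2r// invr_ge0 ltW.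
have h4 : fs / ft - 1 <= k * xs * h / ft.
  have -> : fs / ft - 1 = (fs - ft) / ft by rewrite mulrBl divff ?gt_eqF.
  by rewrite ler_wpM2r// invr_ge0 ltW.
have h5 : p * (ln fs - ln ft) <= p * (k * xs * h / ft).
  by rewrite ler_wpM2l ?(ltW p0)//; lra.
have -> : - (p * k * h * (xs ^+ 2 * fs - xt ^+ 2 * ft) / (fs * ft * xs)) =
  p * k * xt ^+ 2 * h / (fs * xs) - p * (k * xs * h / ft).
  by field; rewrite !gt_eqF.
lra.
Qed.

(** Discrete form of the computation (X / F^p)' <= 0 for F' = - k X and
    X' <= - p k X^2 / F, which needs no differentiability of X. *)
Lemma quotient_nonincreasing (R : realType) (X F : R -> R) (p k S T : R) :
  0 < p -> 0 < k -> S <= T -> 0 < X T -> 0 < F T ->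
  (forall s t, S <= s -> s <= t -> t <= T -> X t <= X s) ->
  (forall s t, S <= s -> s <= t -> t <= T ->
     0 <= F s - F t <= k * X s * (t - s)) ->
  (forall s t, S <= s -> s <= t -> t <= T -> 0 < X t -> 0 < F t ->
     p * k * X t ^+ 2 * (t - s) / F s <= X s - X t) ->
  X T / F T `^ p <= X S / F S `^ p.
Proof.
move=> p0 k0 ST XT FT Xdec Fdec Xdiss.
have HX s : S <= s -> s <= T -> X T <= X s by move=> *; exact: Xdec.
have HF s : S <= s -> s <= T -> F T <= F s.
  by move=> Ss sT; have /andP[] := Fdec s T Ss sT (lexx _); rewrite subr_ge0.
have [XS FS] : 0 < X S /\ 0 < F S.
  by split; [exact: lt_le_trans (HX _ _ _)|exact: lt_le_trans (HF _ _ _)].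
suff : ln (X T) - p * ln (F T) <= ln (X S) - p * ln (F S).
  by rewrite -!ln_powR -!ln_div ?posrE ?powR_gt0// ler_ln ?posrE ?divr_gt0 ?powR_gt0.
pose M t := X t ^+ 2 * F t.
apply: (@le_of_small_increments _ (fun t => ln (X t) - p * ln (F t)) M
  (p * k / (F T * F T * X T))) => //.
  by rewrite divr_ge0 ?mulr_ge0// ?ltW// ?mulr_gt0.
move=> s t Ss st tT.
have [Xt Xs] : 0 < X t /\ 0 < X s.
  by split; apply: lt_le_trans (HX _ _ _) => //; [exact: le_trans st|exact: le_trans tT].
have [Ft Fs] : 0 < F t /\ 0 < F s.
  by split; apply: lt_le_trans (HF _ _ _) => //; [exact: le_trans st|exact: le_trans tT].
have /andP[F1 F2] := Fdec s t Ss st tT; rewrite subr_ge0 in F1.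
have X1 := Xdec s t Ss st tT.
apply: le_trans; last first.
  by apply: (@ln_quotient_step _ p k _ _ _ _ (t - s)) => //; [rewrite subr_ge0|exact: Xdiss].
rewrite lerN2 -/(M s) -/(M t).
have M0 : 0 <= M s - M t.
  rewrite subr_ge0 /M ler_pM ?sqr_ge0 ?(ltW Ft)// lerXn2r ?nnegrE//; exact: ltW.
have -> : p * k / (F T * F T * X T) * (t - s) * (M s - M t) =
  p * k * (t - s) * (M s - M t) / (F T * F T * X T) by ring.
rewrite ler_wpM2l ?mulr_ge0 ?subr_ge0 ?(ltW p0) ?(ltW k0)//.
  by rewrite -subr_ge0.
have sT : s <= T by exact: le_trans tT.
have St : S <= t by exact: le_trans st.
rewrite lef_pV2 ?posrE ?mulr_gt0//.
by rewrite !ler_pM ?mulr_ge0 ?(ltW XT) ?(ltW FT) ?HX ?HF.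
Qed.

(** * Smooth step functions *)

(** The functions x^-n exp (- 1 / x), extended by 0 to x <= 0. *)
Definition flat_exp (R : realType) (n : nat) (x : R) : R :=
  if 0 < x then x ^- n * expR (- x^-1) else 0.

Lemma flat_exp_ge0 (R : realType) n (x : R) : 0 <= flat_exp n x.
Proof.
rewrite /flat_exp; case: ifP => // x0.
by rewrite mulr_ge0 ?expR_ge0// invr_ge0 exprn_ge0// ltW.
Qed.

Lemma flat_exp_gt0 (R : realType) n (x : R) : 0 < x -> 0 < flat_exp n x.
Proof. by move=> x0; rewrite /flat_exp x0 mulr_gt0 ?expR_gt0// invr_gt0 exprn_gt0. Qed.

Lemma flat_exp_le0 (R : realType) n (x : R) : x <= 0 -> flat_exp n x = 0.
Proof. by move=> x0; rewrite /flat_exp ltNge x0. Qed.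

Lemma flat_exp_le_sqr (R : realType) n (x : R) :
  flat_exp n x <= (n.+2)`!%:R * x ^+ 2.
Proof.
rewrite /flat_exp; case: ifPn => [x0|_]; last by rewrite mulr_ge0// sqr_ge0.
have y0 : 0 <= x^-1 by rewrite invr_ge0 ltW.
have h := expR_ge1Dxn n.+1 y0.
have {}h : x ^- n.+2 / (n.+2)`!%:R <= expR x^-1.
  by rewrite -exprVn; apply: le_trans h; rewrite lerDr.
have f0 : 0 < (n.+2)`!%:R :> R by rewrite ltr0n fact_gt0.
rewrite expRN ler_pdivrMr ?expR_gt0//.
have -> : x ^- n = (n.+2)`!%:R * x ^+ 2 * (x ^- n.+2 / (n.+2)`!%:R).
  by rewrite -[n.+2]addn2 exprD; field; rewrite expf_neq0 ?gt_eqF// addn2 f0 x0.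
by rewrite ler_wpM2l// mulr_ge0 ?ltW ?exprn_gt0.
Qed.

(** The family of the flat_exp n is closed under differentiation up to linear
    combinations, which is why these functions are smooth at 0. *)
Lemma is_derive_flat_exp (R : realType) n (x : R) :
  is_derive x 1 (flat_exp n) (flat_exp n.+2 x - n%:R * flat_exp n.+1 x).
Proof.
have [x0|x0|->] := ltgtP x 0.
- rewrite !flat_exp_le0 ?ltW// mulr0 subr0.
  apply: (@near_eq_is_derive _ _ _ (cst 0)).
    by near=> y; rewrite flat_exp_le0//; apply: ltW; near: y; exact: lt_nbhsl.
- have xn0 : x != 0 by rewrite gt_eqF.
  have dV : is_derive x 1 (fun y : R => y^-1) (- x ^- 2).
    have := is_deriveV (f := id) xn0 (is_derive_id x 1).
    by rewrite /= -[_ *: _]/(_ * _) mulr1.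
  have dE : is_derive x 1 (fun y : R => expR (- y^-1)) (expR (- x^-1) * x ^- 2).
    have := is_derive1_comp (g := fun y : R => - y^-1)
      (is_derive_expR (- x^-1)) (is_deriveN dV).
    by rewrite opprK.
  have dX : is_derive x 1 (fun y : R => y ^- n) (- n%:R * x ^- n.+1).
    have dXn : is_derive x 1 (fun y : R => y ^+ n) (n%:R * x ^+ n.-1).
      have := is_derive_poly 'X^n x; rewrite derivXn hornerMn hornerXn mulr_natl.
      by rewrite (_ : horner _ = fun y => y ^+ n)//; apply/funext => y; rewrite hornerXn.
    have := is_deriveV (f := fun y : R => y ^+ n) (expf_neq0 n xn0) dXn.
    move=> H; apply: is_derive_eq H _.
    rewrite -![_ *: _]/(_ * _).
    case: (n) => [|m]; first by rewrite !mul0r oppr0 mulr0 mul0r.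
    rewrite /= !exprS; field; by rewrite xn0 expf_neq0.
  have dP := is_deriveM dX dE.
  apply: near_eq_is_derive; last first.
    apply: is_derive_eq dP _.
    rewrite /flat_exp x0 -![_ *: _]/(_ * _) !exprS; field.
    by rewrite xn0 expf_neq0.
  near=> y; rewrite /flat_exp ifT//; near: y; exact: lt_nbhsr.
apply/is_derive1_caratheodory; rewrite !flat_exp_le0//.
exists (fun z => flat_exp n z / z); split.
- move=> z; rewrite !subr0; have [->|z0] := eqVneq z 0.
    by rewrite flat_exp_le0// !mul0r.
  by rewrite divfK.
- rewrite /prop_for /continuous_at (flat_exp_le0 _ (lexx 0)) mul0r. 
  have h : (n.+2)`!%:R * `|z| @[z --> (0 : R)] --> (0 : R).
    have : (n.+2)`!%:R * `|z| @[z --> (0 : R)] --> (n.+2)`!%:R * `|0 : R|.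
      by apply: cvgM; [exact: cvg_cst|exact: norm_continuous].
    by rewrite normr0 mulr0.
  have hN : - ((n.+2)`!%:R * `|z|) @[z --> (0 : R)] --> (0 : R).
    by rewrite -[X in _ --> X]oppr0; exact: (cvgN h).
  apply: (@squeeze_cvgr _ _ _ _ (fun z => - ((n.+2)`!%:R * `|z|))
    (fun z => (n.+2)`!%:R * `|z|)) => //.
  + near=> z; rewrite -ler_norml normrM normfV (ger0_norm (flat_exp_ge0 _ _)).
    have [->|z0] := eqVneq z 0; first by rewrite normr0 invr0 !mulr0.
    rewrite ler_pdivrMr ?normr_gt0// -mulrA -expr2 -normrX ger0_norm ?sqr_ge0//.
    exact: flat_exp_le_sqr.
- by rewrite invr0 !mulr0 subr0.
Unshelve. all: by end_near. Qed.

(** A class of functions stable under the operations below and, as a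
    consequence, under differentiation; its members are therefore smooth. *)
Inductive smooth_elementary (R : realType) : (R -> R) -> Prop :=
| SE_flat n a b : smooth_elementary (fun x => flat_exp n (a * x + b))
| SE_cst c : smooth_elementary (fun=> c)
| SE_add f g : smooth_elementary f -> smooth_elementary g ->
    smooth_elementary (fun x => f x + g x)
| SE_mul f g : smooth_elementary f -> smooth_elementary g ->
    smooth_elementary (fun x => f x * g x)
| SE_inv f : (forall x, f x != 0) -> smooth_elementary f ->
    smooth_elementary (fun x => (f x)^-1).

Lemma is_derive_flat_exp_affine (R : realType) n (a b x : R) :
  is_derive x 1 (fun x => flat_exp n (a * x + b))
    (a * (flat_exp n.+2 (a * x + b) - n%:R * flat_exp n.+1 (a * x + b))).
Proof.
have dA : is_derive x 1 (fun x : R => a * x + b) a.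
  have := is_deriveD (is_deriveM (is_derive_cst a x 1) (is_derive_id x 1))
    (is_derive_cst b x 1).
  by move=> H; apply: is_derive_eq H _; rewrite scaler0 !addr0 -[_ *: _]/(_ * _) mulr1.
have := is_derive1_comp (g := fun x : R => a * x + b)
  (is_derive_flat_exp n (a * x + b)) dA.
by rewrite [X in is_derive _ _ _ X]mulrC.
Qed.

Lemma smooth_elementary_derive (R : realType) (f : R -> R) :
  smooth_elementary f ->
  exists2 f', smooth_elementary f' & forall x : R, is_derive x 1 f (f' x).
Proof.
elim=> {f} [n a b|c|f g Sf [f' Sf' df] Sg [g' Sg' dg]
  |f g Sf [f' Sf' df] Sg [g' Sg' dg]|f f0 Sf [f' Sf' df]].
- exists (fun x => a * (flat_exp n.+2 (a * x + b) +
      (- n%:R) * flat_exp n.+1 (a * x + b))).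
    apply: (SE_mul (SE_cst a)); apply: (SE_add (SE_flat _ _ _)).
    exact: (SE_mul (SE_cst _) (SE_flat _ _ _)).
  by move=> x; rewrite mulNr; exact: is_derive_flat_exp_affine.
- exists (fun=> 0) => [|x]; first exact: SE_cst.
  exact: is_derive_cst.
- exists (fun x => f' x + g' x) => [|x]; first exact: SE_add Sf' Sg'.
  exact: is_deriveD.
- exists (fun x => f x * g' x + g x * f' x) => [|x].
    exact: SE_add (SE_mul Sf Sg') (SE_mul Sg Sf').
  exact: is_deriveM.
- exists (fun x => - 1 * ((f x)^-1 * (f x)^-1) * f' x) => [|x].
    apply: SE_mul Sf'; apply: (SE_mul (SE_cst _)).
    exact: SE_mul (SE_inv f0 Sf) (SE_inv f0 Sf).
  by apply: is_derive_eq (is_deriveV (f0 x) (df x)) _;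
    rewrite -[_ *: _]/(_ * _) mulN1r expr2 invfM.
Qed.

Lemma smooth_elementary_smooth (R : realType) (f : R -> R) :
  smooth_elementary f -> smooth_R f.
Proof.
move=> Sf k; elim: k f Sf => [|k IH] f /smooth_elementary_derive[f' Sf' df] x.
  by rewrite derive1n0; have [] := df x.
rewrite derive1Sn; have -> : f^`()%classic = f'; last exact: IH.
by apply/funext => y; rewrite derive1E; have [_] := df y.
Qed.

(** For a < b, a smooth nondecreasing function equal to 0 on ]-oo, a] and to 1
    on [b, +oo[. *)
Definition smooth_step (R : realType) (a b x : R) : R :=
  flat_exp 0 (x - a) / (flat_exp 0 (x - a) + flat_exp 0 (b - x)).

(** The derivative of smooth_step a b. *)
Definition smooth_step' (R : realType) (a b x : R) : R :=
  (flat_exp 2 (x - a) * flat_exp 0 (b - x) +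
   flat_exp 0 (x - a) * flat_exp 2 (b - x)) /
  (flat_exp 0 (x - a) + flat_exp 0 (b - x)) ^+ 2.

Section smooth_step.
Context {R : realType} (a b : R).
Hypothesis ab : a < b.

Let den_gt0 x : 0 < flat_exp 0 (x - a) + flat_exp 0 (b - x).
Proof.
have [ax|xa] := ltP a x.
  by rewrite ltr_pwDl ?flat_exp_ge0// flat_exp_gt0// subr_gt0.
by rewrite ltr_wpDl ?flat_exp_ge0// flat_exp_gt0// subr_gt0 (le_lt_trans xa).
Qed.

(* the arguments x - a and b - x in the affine form of SE_flat *)
Let flatE n x : flat_exp n (x - a) = flat_exp n (1 * x + - a).
Proof. by rewrite mul1r. Qed.

Let flatE' n x : flat_exp n (b - x) = flat_exp n (-1 * x + b).
Proof. by rewrite mulN1r addrC. Qed.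

Lemma smooth_elementary_step : smooth_elementary (smooth_step a b).
Proof.
rewrite (_ : smooth_step a b = fun x => flat_exp 0 (1 * x + - a) *
  (flat_exp 0 (1 * x + - a) + flat_exp 0 (-1 * x + b))^-1); last first.
  by apply/funext => x; rewrite /smooth_step flatE flatE'.
apply: SE_mul; first exact: SE_flat.
apply: SE_inv; first by move=> x; rewrite -flatE -flatE' gt_eqF.
by apply: SE_add; exact: SE_flat.
Qed.

Lemma smooth_elementary_step' : smooth_elementary (smooth_step' a b).
Proof.
rewrite (_ : smooth_step' a b = fun x =>
  (flat_exp 2 (1 * x + - a) * flat_exp 0 (-1 * x + b) +
   flat_exp 0 (1 * x + - a) * flat_exp 2 (-1 * x + b)) *
  ((flat_exp 0 (1 * x + - a) + flat_exp 0 (-1 * x + b)) *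
   (flat_exp 0 (1 * x + - a) + flat_exp 0 (-1 * x + b)))^-1); last first.
  by apply/funext => x; rewrite -!flatE -!flatE' /smooth_step' expr2.
apply: SE_mul; first by apply: SE_add; apply: SE_mul; exact: SE_flat.
apply: SE_inv; first by move=> x; rewrite -flatE -flatE' mulf_neq0 ?gt_eqF.
by apply: SE_mul; apply: SE_add; exact: SE_flat.
Qed.

Lemma is_derive_smooth_step (x : R) :
  is_derive x 1 (smooth_step a b) (smooth_step' a b x).
Proof.
have dA : is_derive x 1 (fun x => flat_exp 0 (x - a)) (flat_exp 2 (x - a)).
  have := is_derive_flat_exp_affine 0 1 (- a) x.
  by under eq_fun do rewrite -flatE; rewrite mul0r subr0 mul1r -flatE.
have dB : is_derive x 1 (fun x => flat_exp 0 (b - x)) (- flat_exp 2 (b - x)).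
  have := is_derive_flat_exp_affine 0 (-1) b x.
  by under eq_fun do rewrite -flatE'; rewrite mul0r subr0 mulN1r -flatE'.
have d0 : flat_exp 0 (x - a) + flat_exp 0 (b - x) != 0 by rewrite gt_eqF.
have := is_deriveM dA (is_deriveV
  (f := fun x => flat_exp 0 (x - a) + flat_exp 0 (b - x)) d0 (is_deriveD dA dB)).
move=> H; apply: is_derive_eq H _.
by rewrite -![_ *: _]/(_ * _) /smooth_step'; field.
Qed.

Lemma smooth_step'_ge0 x : 0 <= smooth_step' a b x.
Proof. by rewrite divr_ge0 ?sqr_ge0// addr_ge0// mulr_ge0// flat_exp_ge0. Qed.

Lemma smooth_step_ge0 x : 0 <= smooth_step a b x.
Proof. by rewrite divr_ge0 ?flat_exp_ge0// ltW. Qed.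

Lemma smooth_step_le1 x : smooth_step a b x <= 1.
Proof. by rewrite ler_pdivrMr// mul1r lerDl flat_exp_ge0. Qed.

Lemma smooth_step_left x : x <= a -> smooth_step a b x = 0.
Proof. by move=> xa; rewrite /smooth_step flat_exp_le0 ?subr_le0// mul0r. Qed.

Lemma smooth_step_right x : b <= x -> smooth_step a b x = 1.
Proof.
move=> bx; rewrite /smooth_step (@flat_exp_le0 _ _ (b - x)) ?subr_le0// addr0 divff//.
by rewrite gt_eqF// flat_exp_gt0// subr_gt0 (lt_le_trans ab).
Qed.

Lemma smooth_step'_eq0 x : ~~ (a < x < b) -> smooth_step' a b x = 0.
Proof.
rewrite negb_and -!leNgt => /orP[xa|bx]; rewrite /smooth_step'.
  by rewrite !(@flat_exp_le0 _ _ (x - a)) ?subr_le0// !mul0r addr0 mul0r.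
by rewrite !(@flat_exp_le0 _ _ (b - x)) ?subr_le0// !mulr0 addr0 mul0r.
Qed.

Lemma continuous_smooth_step' : continuous (smooth_step' a b).
Proof.
move=> x; have [f' _ df] := smooth_elementary_derive smooth_elementary_step'.
by apply: differentiable_continuous; apply/derivable1_diffP; have [] := df x.
Qed.

End smooth_step.

(** * Increments of weakly differentiable functions *)

(** Integrals are suprema over simple functions below the integrand, so that
    monotonicity holds without measurability. *)
Lemma ge0_le_integral_nonmeas d (T : measurableType d) (R : realType)
    (mu : {measure set T -> \bar R}) (D : set T) (f g : T -> \bar R) :
  (forall x, D x -> (0 <= f x)%E) -> (forall x, D x -> (f x <= g x)%E) ->
  (\int[mu]_(x in D) f x <= \int[mu]_(x in D) g x)%E.
Proof.
move=> f0 fg; rewrite !ge0_integralE//; last first.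
  by move=> x Dx; exact: le_trans (f0 x Dx) (fg x Dx).
apply: le_ereal_sup => _ [h hf <-]; exists h => // x.
apply: le_trans (hf x) _; rewrite !patchE; case: ifPn => // xD.
by apply: fg; rewrite inE in xD.
Qed.

Lemma le_normr_Rintegral d (T : measurableType d) (R : realType)
    (mu : {measure set T -> \bar R}) (D : set T) (f : T -> R) (g : T -> \bar R) :
  (forall x, D x -> ((`|f x|)%:E <= g x)%E) ->
  ((`|\int[mu]_(x in D) f x|)%:E <= \int[mu]_(x in D) g x)%E.
Proof.
move=> fg; rewrite /Rintegral integralE.
set a := (\int[mu]_(x in D) _^\+ x)%E; set b := (\int[mu]_(x in D) _^\- x)%E.
have a0 : (0 <= a)%E by apply: integral_ge0 => x _; rewrite funepos_ge0.
have b0 : (0 <= b)%E by apply: integral_ge0 => x _; rewrite funeneg_ge0.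
have ag : (a <= \int[mu]_(x in D) g x)%E.
  apply: ge0_le_integral_nonmeas => x Dx; first exact: funepos_ge0.
  apply: le_trans (fg x Dx); rewrite funeposE -EFin_max lee_fin ge_max ler_norm.
  exact: normr_ge0.
have bg : (b <= \int[mu]_(x in D) g x)%E.
  apply: ge0_le_integral_nonmeas => x Dx; first exact: funeneg_ge0.
  apply: le_trans (fg x Dx); rewrite funenegE -EFinN -EFin_max lee_fin ge_max.
  by rewrite -normrN ler_norm normr_ge0.
have h0 : (0 <= \int[mu]_(x in D) g x)%E by exact: le_trans ag.
clear -a0 b0 ag bg h0.
case: a b a0 b0 ag bg => [a| |] [b| |] //=; rewrite ?normr0// => a0 b0 ag bg.
have [ab|ba] := leP a b.
  apply: le_trans bg; rewrite lee_fin ler0_norm ?subr_le0//.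
  by rewrite opprB; rewrite lee_fin in a0; lra.
apply: le_trans ag; rewrite lee_fin ger0_norm ?subr_ge0 ?(ltW ba)//.
by rewrite lee_fin in b0; lra.
Qed.

Lemma Rintegral_support d (T : measurableType d) (R : realType)
    (mu : {measure set T -> \bar R}) (A B : set T) (f : T -> R) :
  B `<=` A -> (forall x, A x -> ~ B x -> f x = 0) ->
  \int[mu]_(x in A) f x = \int[mu]_(x in B) f x.
Proof.
move=> BA f0; rewrite Rintegral_mkcond [RHS]Rintegral_mkcond.
congr Rintegral; apply/funext => x; rewrite !patchE.
case: ifPn => [|] xA; case: ifPn => [|] xB //.
- by apply: f0; [rewrite inE in xA|rewrite notin_setE in xB].
- by rewrite inE in xB; move: xA; rewrite notin_setE => /(_ (BA _ xB)).
Qed.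

(** If h is the weak derivative of g on ]0, +oo[ and b dominates |h|, then the
    increment of g over [s, t] is at most the integral of b.  The test function
    is a plateau supported inside ]s, t[, so that no measurability of h and no
    limit on the right-hand side are needed; s = 0 is allowed. *)
Lemma weak_deriv_le_increment (R : realType) (g h : R -> R) (b : R -> \bar R)
    (s t : R) :
  weak_deriv `]0, +oo[ g h -> 0 <= s -> s < t ->
  {within `[s, t], continuous g} ->
  (forall r, s < r < t -> (`|h r|%:E <= b r)%E) ->
  ((g t - g s)%:E <= \int[lebesgue_measure]_(r in `]s, t[) b r)%E.
Proof.
move=> wd s0 st cg hb.
apply/lee_addgt0Pr => eta' eta'0; pose eta := eta' / 2.
have eta0 : 0 < eta by rewrite divr_gt0.
have [e [e0 e4 gs gt]] : exists e : R, [/\ 0 < e, e *+ 4 <= t - s,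
    forall r, s <= r <= s + e *+ 2 -> g r <= g s + eta &
    forall r, t - e *+ 2 <= r <= t -> g t - eta <= g r].
  move: cg => /(continuous_within_itvP _ st)[_ gs gt].
  have /cvgrPdist_le /(_ _ eta0) := gs.
  rewrite near_withinE => -[e1 /= e10 H1].
  have /cvgrPdist_le /(_ _ eta0) := gt.
  rewrite near_withinE => -[e2 /= e20 H2].
  pose e := Order.min ((t - s) / 4) (Order.min (e1 / 4) (e2 / 4)).
  have eE : [/\ 0 < e, e <= (t - s) / 4, e <= e1 / 4 & e <= e2 / 4].
    by split; rewrite /e ?lt_min ?ge_min ?lexx ?orbT// !divr_gt0// subr_gt0.
  have [h0 h1 h2 h3] := eE.
  exists e; split => //; first by lra.
  - move=> r /andP[sr re]; have [->|rs] := eqVneq r s; first by lra.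
    have sr' : s < r by rewrite lt_neqAle eq_sym rs.
    have : `|g s - g r| <= eta by apply: H1 => //=; rewrite ltr_distlC; lra.
    by rewrite ler_distl; lra.
  - move=> r /andP[sr re]; have [->|rs] := eqVneq r t; first by lra.
    have sr' : r < t by rewrite lt_neqAle rs.
    have : `|g t - g r| <= eta by apply: H2 => //=; rewrite ltr_distlC; lra.
    by rewrite ler_distl; lra.
have e2 : e *+ 2 = e + e by rewrite mulr2n.
have e4' : e *+ 4 = e + e + e + e by rewrite !mulrS addr0 !addrA.
(* phi climbs from 0 to 1 over [al, be] and descends over [ga, de] *)
pose al := s + e; pose be := s + e *+ 2.
pose ga := t - e *+ 2; pose de := t - e.
have [ab bg gd] : [/\ al < be, be <= ga & ga < de] by rewrite /al /be /ga /de; split; lra.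
pose up := smooth_step al be; pose dn := smooth_step ga de.
pose phi x := up x + (-1) * dn x.
pose phi' x := smooth_step' al be x - smooth_step' ga de x.
have dphi (x : R) : is_derive x 1 phi (phi' x).
  have := is_deriveB (is_derive_smooth_step ab x) (is_derive_smooth_step gd x).
  by rewrite (_ : _ - _ = phi)//; apply/funext => y; rewrite /phi mulN1r.
have dphiE : derive1 phi = phi'.
  by apply/funext => x; rewrite derive1E; have [] := dphi x.
have phi_out x : ~~ (al < x < de) -> phi x = 0.
  rewrite negb_and -!leNgt /phi /up /dn => /orP[xa|dx].
    by rewrite !smooth_step_left// ?mulr0 ?addr0//; lra.
  by rewrite !smooth_step_right//; lra.
have phi'_out x : ~~ (al < x < de) -> phi' x = 0.
  move=> h1; rewrite /phi' !smooth_step'_eq0 ?subr0//; apply: contra h1; lra.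
have phi01 x : `|phi x| <= 1.
  rewrite ler_norml /phi /up /dn; have := smooth_step_ge0 ab x; have := smooth_step_le1 ab x.
  have := smooth_step_ge0 gd x; have := smooth_step_le1 gd x; lra.
have Tphi : test_R `]0, +oo[ phi.
  split.
    apply: smooth_elementary_smooth; apply: SE_add.
      exact: smooth_elementary_step.
    by apply: (SE_mul (SE_cst _)); exact: smooth_elementary_step.
  exists `[al, de]%classic; split; first exact: segment_compact.
    by move=> x /=; rewrite !in_itv/= andbT; rewrite /al; lra.
  move=> x /= /negP; rewrite in_itv/= => h1; apply: phi_out.
  by apply: contra h1; lra.
have := wd _ Tphi; rewrite dphiE.

rewrite (Rintegral_support lebesgue_measure (B := `[al, de])); last 2 first.
  by move=> x /=; rewrite !in_itv/= andbT; rewrite /al; lra.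
  move=> x _ /= /negP; rewrite in_itv/= => h1; rewrite phi'_out ?mul0r//.
  by apply: contra h1; lra.
rewrite (@Rintegral_support _ _ _ lebesgue_measure `]0, +oo[ `]s, t[
  (fun x => phi x * h x)); last 2 first.
  by move=> x /=; rewrite !in_itv/= andbT; lra.
  move=> x _ /= /negP; rewrite in_itv/= => h1; rewrite phi_out ?mul0r//.
  by apply: contra h1; rewrite /al /de; lra.
move=> wdE.
have phi'_cont : continuous phi'.
  move=> x; apply: cvgB; exact: continuous_smooth_step'.
(* f majorizes phi' g: on the climb g <= g s + eta, on the descent
   g >= g t - eta *)
pose F x := (g s + eta) * up x + (- (g t - eta)) * dn x.
pose f x := (g s + eta) * smooth_step' al be x + (- (g t - eta)) * smooth_step' ga de x.
have f_cont : continuous f.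
  by move=> x; apply: cvgD; apply: cvgM; (exact: cvg_cst || exact: continuous_smooth_step').
have dF (x : R) : is_derive x 1 F (f x).
  have := is_deriveD (is_deriveZ (g s + eta) (is_derive_smooth_step ab x))
   (is_deriveZ (- (g t - eta)) (is_derive_smooth_step gd x)).
  by [].
have F_cont : continuous F.
  by move=> x; apply: differentiable_continuous; apply/derivable1_diffP; have [] := dF x.
have ad : al < de by lra.
have If : \int[lebesgue_measure]_(x in `[al, de]) f x = g s + eta - (g t - eta).
  rewrite /Rintegral (@continuous_FTC2 _ f F)//.
  - have -> : F de = g s + eta - (g t - eta).
      by rewrite /F /up /dn !smooth_step_right// ?mulr1//; lra.
    have -> : F al = 0 by rewrite /F /up /dn !smooth_step_left ?mulr0 ?addr0//; lra.
    by rewrite -EFinB/=; ring.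
  - exact: continuous_subspaceT.
  - split; first by move=> x _; have [] := dF x.
    + by apply: cvg_at_right_filter; exact: F_cont.
    + by apply: cvg_at_left_filter; exact: F_cont.
  - by move=> x _; rewrite derive1E; have [_] := dF x.
have subst : `[al, de] `<=` `[s, t].
  by move=> x /=; rewrite !in_itv/=; rewrite /al /de; lra.
have lef : \int[lebesgue_measure]_(x in `[al, de]) (phi' x * g x) <= g s + eta - (g t - eta).
  rewrite -If.
  apply: le_Rintegral => //.
  - apply: continuous_compact_integrable; first exact: segment_compact.
    move=> x; apply: cvgM; last exact: continuous_subspaceW subst cg x.
    exact: continuous_subspaceT phi'_cont x.
  - apply: continuous_compact_integrable; first exact: segment_compact.
    exact: continuous_subspaceT.
  - move=> x; rewrite /= in_itv/= => /andP[ax xd].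
    rewrite /f /phi'.
    have h1 : smooth_step' al be x * g x <= smooth_step' al be x * (g s + eta).
      have [h1|h1] := boolP (al < x < be); last by rewrite smooth_step'_eq0// !mul0r.
      rewrite ler_wpM2l ?smooth_step'_ge0//; apply: gs; rewrite /al /be in h1; lra.
    have h2 : smooth_step' ga de x * (g t - eta) <= smooth_step' ga de x * g x.
      have [h2|h2] := boolP (ga < x < de); last by rewrite smooth_step'_eq0// !mul0r.
      rewrite ler_wpM2l ?smooth_step'_ge0//; apply: gt; rewrite /ga /de in h2; lra.
    lra.
have : ((`|\int[lebesgue_measure]_(x in `]s, t[) (phi x * h x)|)%:E <=
    \int[lebesgue_measure]_(x in `]s, t[) b x)%E.
  apply: le_normr_Rintegral => x; rewrite /= in_itv/= => xst.
  apply: le_trans (hb x xst); rewrite lee_fin normrM ler_piMl//.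
rewrite wdE in lef => h1.
rewrite -leeBlDr//; apply: le_trans h1; rewrite lee_fin.
apply: le_trans (ler_norm _); rewrite /eta in lef; lra.
Qed.

(** * Power inequalities *)

Lemma spowM (R : realType) (r x y : R) : spow r (x * y) = spow r x * spow r y.
Proof. by rewrite /spow normrM powRM//; ring. Qed.

Lemma spow0 (R : realType) (r : R) : spow r 0 = 0.
Proof. by rewrite /spow mulr0. Qed.

Lemma spow_gt0E (R : realType) (r x : R) : 0 < x -> spow r x = x `^ (r + 1).
Proof.
by move=> x0; rewrite /spow gtr0_norm// powRD ?powRr1 ?(ltW x0)// (gt_eqF x0) implybT.
Qed.

(** Bernoulli's inequality for a real exponent, from y ln y >= y - 1. *)
Lemma bernoulli_powR (R : realType) (k y : R) : 1 <= k -> 0 < y ->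
  1 - y `^ k <= k * (1 - y).
Proof.
move=> k1 y0.
have lnle (z : R) : 0 < z -> ln z <= z - 1.
  by move=> z0; have := expR_ge1Dx (ln z); rewrite lnK//; lra.
have h1 : y - 1 <= y * ln y.
  have := lnle y^-1; rewrite invr_gt0 lnV ?posrE// => /(_ y0) h.
  have : y * (1 - y^-1) <= y * ln y by rewrite ler_wpM2l ?(ltW y0)//; lra.
  by rewrite mulrBr mulr1 divff ?gt_eqF.
have h2 : 1 + (k - 1) * ln y <= y `^ (k - 1).
  by rewrite /powR gt_eqF// expR_ge1Dx.
have -> : y `^ k = y * y `^ (k - 1).
  by rewrite -{2}[y]powRr1 ?ltW// -powRD ?subrKC// (gt_eqF y0) implybT.
have h3 : y * (1 + (k - 1) * ln y) <= y * y `^ (k - 1) by rewrite ler_wpM2l ?(ltW y0).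
have : (k - 1) * (y - 1) <= (k - 1) * (y * ln y) by rewrite ler_wpM2l ?subr_ge0.
lra.
Qed.

Lemma powR_le_exp (R : realType) (x a b : R) : 0 < x -> x <= 1 -> a <= b ->
  x `^ b <= x `^ a.
Proof.
move=> x0 x1 ab; rewrite /powR gt_eqF// ler_expR ler_wnM2r//.
exact: ln_le0.
Qed.

(** The case a = 1 of the next lemma.  For x > 0, put b = q - 1 and
    m = (1 + b) / 2, which lies between 1 and b: then 1 - x^m is at most
    1 - x^max(1, b), and at most (m / min(1, b)) (1 - x^min(1, b)) by
    Bernoulli's inequality. *)
Lemma spow_diff_sqr_unit (R : realType) (q x : R) : 1 < q -> `|x| <= 1 ->
  (1 - spow ((q - 2) / 2) x) ^+ 2 <=
  (4 + q / 2 / Order.min 1 (q - 1)) * ((1 - x) * (1 - spow (q - 2) x)).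
Proof.
move=> q1 x1.
have g0 : 0 < Order.min 1 (q - 1) by rewrite lt_min ltr01 subr_gt0.
have C0 : 0 <= q / 2 / Order.min 1 (q - 1) by rewrite !divr_ge0 ?ltW//; lra.
have [x0|x0] := leP x 0.
  have s1 r : 0 <= r + 1 -> -1 <= spow r x <= 0.
    move=> r0; have [->|xn0] := eqVneq x 0; first by rewrite spow0; lra.
    have xlt0 : 0 < - x by rewrite oppr_gt0 lt_neqAle xn0.
    have -> : spow r x = - spow r (- x) by rewrite /spow normrN; ring.
    rewrite spow_gt0E// oppr_le0 powR_ge0 andbT lerN2 -[leRHS](powRr0 (- x)).
    by rewrite powR_le_exp// -(ler0_norm x0).
  have /andP[a1 a2] := s1 ((q - 2) / 2) ltac:(lra).
  have /andP[b1 b2] := s1 (q - 2) ltac:(lra).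
  have h1 : (1 - spow ((q - 2) / 2) x) ^+ 2 <= 4.
    rewrite -[leRHS]/(4%:R) (_ : 4%:R = 2 ^+ 2); last by rewrite -natrX.
    by rewrite lerXn2r ?nnegrE//; lra.
  have h2 : 1 <= (1 - x) * (1 - spow (q - 2) x) by nra.
  nra.
have xl1 : x <= 1 by apply: le_trans x1; exact: ler_norm.
rewrite !spow_gt0E//.
set m := _ + 1; set be := q - 2 + 1.
have mE : m = (1 + be) / 2 by rewrite /m /be; lra.
have beE : be = q - 1 by rewrite /be; lra.
rewrite -beE in g0 C0 *.
have qE : q / 2 = m by lra.
rewrite qE in C0 *.
set ga := Order.min 1 be in g0 C0 *.
have gam : ga <= m by rewrite /ga; case: (leP 1 be) => ?; lra.
have mM : m <= Order.max 1 be by case: (leP 1 be) => ?; lra.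
have hg : 1 - x `^ m <= m / ga * (1 - x `^ ga).
  have -> : x `^ m = (x `^ ga) `^ (m / ga) by rewrite -powRrM mulrCA divff ?mulr1 ?gt_eqF.
  by rewrite bernoulli_powR ?powR_gt0// ler_pdivlMr// mul1r.
have hM : 1 - x `^ m <= 1 - x `^ (Order.max 1 be) by rewrite lerB// powR_le_exp.
have p0 e : 0 <= e -> 0 <= 1 - x `^ e.
  by move=> e0; rewrite subr_ge0 -[leRHS](powRr0 x) powR_le_exp.
have m0 : 0 <= 1 - x `^ m by apply: p0; lra.
have M0 : 0 <= 1 - x `^ (Order.max 1 be) by exact: le_trans hM.
have G0 : 0 <= 1 - x `^ ga by apply: p0; exact: ltW.
have prod : (1 - x `^ ga) * (1 - x `^ Order.max 1 be) = (1 - x) * (1 - x `^ be).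
  rewrite /ga; case: (leP 1 be) => _; rewrite ?(powRr1 (ltW x0))//; exact: mulrC.
rewrite -prod; set A := 1 - x `^ ga in hg G0 *.
set B := (1 - x `^ Order.max 1 be) in hM M0 *.
set Z := 1 - x `^ m in hg hM m0 *; set K := m / ga in C0 hg *.
have : Z * Z <= K * A * B by rewrite ler_pM.
have : 0 <= A * B by rewrite mulr_ge0.
rewrite expr2; lra.
Qed.

(** The map |x|^((q-2)/2) x is controlled by the monotonicity of |x|^(q-2) x;
    all three maps are multiplicative, so one of the arguments may be scaled
    to 1. *)
Lemma spow_diff_sqr (R : realType) (q : R) : 1 < q ->
  exists2 C : R, 0 <= C & forall a b : R,
    (spow ((q - 2) / 2) a - spow ((q - 2) / 2) b) ^+ 2 <=
    C * ((a - b) * (spow (q - 2) a - spow (q - 2) b)).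
Proof.
move=> q1; exists (4 + q / 2 / Order.min 1 (q - 1)).
  by rewrite addr_ge0// !divr_ge0//; [lra|rewrite le_min ler01; lra].
move=> a b; wlog ba : a b / `|b| <= `|a|.
  have [h|/ltW h] := leP `|b| `|a|; first by move/(_ a b h).
  move=> H.
  have := H b a h; rewrite -sqrrN opprB; congr (_ <= _); ring.
have [a0|a0] := eqVneq a 0.
  move: ba; rewrite a0 normr0 normr_le0 => /eqP ->.
  by rewrite !subrr expr0n mul0r mulr0.
have -> : b = b / a * a by rewrite divfK.
set x := b / a.
have x1 : `|x| <= 1 by rewrite normf_div ler_pdivrMr ?normr_gt0// mul1r.
have := spow_diff_sqr_unit q1 x1; rewrite !(spowM _ x).
set S := spow ((q - 2) / 2) a; set Y := spow (q - 2) a.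
have SY : S ^+ 2 = a * Y.
  rewrite /S /Y /spow exprMn expr2 -powRD; last by rewrite normr_eq0 a0 implybT.
  by rewrite -splitr; ring.
have -> : S - spow ((q - 2) / 2) x * S = S * (1 - spow ((q - 2) / 2) x) by ring.
have -> : (a - x * a) * (Y - spow (q - 2) x * Y) =
  (a * Y) * ((1 - x) * (1 - spow (q - 2) x)) by ring.
by move=> h; rewrite exprMn SY [leRHS]mulrCA ler_wpM2l -?SY ?sqr_ge0.
Qed.

(** * Square-integrable functions *)

Section square_integrable.
Context d (T : measurableType d) (R : realType).
Variables (mu : {measure set T -> \bar R}) (D : set T).
Hypothesis mD : measurable D.
Implicit Types f g w : T -> R.

(** Membership in L^2(D), for real-valued functions. *)
Definition sq_integrable f :=
  measurable_fun D f /\ mu.-integrable D (EFin \o (fun x => f x ^+ 2)).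

Lemma sq_integrable_mul f g : sq_integrable f -> sq_integrable g ->
  mu.-integrable D (EFin \o (fun x => f x * g x)).
Proof.
move=> [mf f2] [mg g2]; apply: le_integrable (integrableD mD f2 g2) => //.
  by apply/measurable_EFinP; exact: measurable_funM.
move=> x Dx /=; rewrite lee_fin normrM [leRHS]ger0_norm ?addr_ge0 ?sqr_ge0//.
rewrite -(real_normK (num_real (f x))) -(real_normK (num_real (g x))).
have := normr_ge0 (f x); have := normr_ge0 (g x).
set a := `|f x|; set b := `|g x|; nra.
Qed.

Lemma sq_integrableDZ (a b : R) f g : sq_integrable f -> sq_integrable g ->
  sq_integrable (fun x => a * f x + b * g x).
Proof.
move=> If Ig; have [mf f2] := If; have [mg g2] := Ig; split.
  by apply: measurable_funD; apply: measurable_funM.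
have -> : EFin \o (fun x => (a * f x + b * g x) ^+ 2) =
   ((fun x => (a ^+ 2)%:E * (EFin \o (fun x => (f x ^+ 2)%R)) x) \+
    ((fun x => (a * b *+ 2)%:E * (EFin \o (fun x => (f x * g x)%R)) x) \+
    (fun x => (b ^+ 2)%:E * (EFin \o (fun x => (g x ^+ 2)%R)) x)))%E.
  by apply/funext => x /=; rewrite -!EFinM -!EFinD; congr EFin; ring.
do ?apply: integrableD => //; apply: integrableZl => //.
exact: sq_integrable_mul.
Qed.

Lemma Rintegral_sqrDZ (a b : R) f g : sq_integrable f -> sq_integrable g ->
  \int[mu]_(x in D) (a * f x + b * g x) ^+ 2 =
  a ^+ 2 * \int[mu]_(x in D) f x ^+ 2 + a * b *+ 2 * \int[mu]_(x in D) (f x * g x)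
  + b ^+ 2 * \int[mu]_(x in D) g x ^+ 2.
Proof.
move=> If Ig; have [mf f2] := If; have [mg g2] := Ig.
have Ifg := sq_integrable_mul If Ig.
have Z (c : R) h : mu.-integrable D (EFin \o h) ->
    mu.-integrable D (EFin \o (fun x => c * h x)).
  move=> Ih; rewrite (_ : _ \o _ = fun x => c%:E * (EFin \o h) x)%E//.
  exact: integrableZl.
have Ia := Z (a ^+ 2) _ f2; have Ib := Z (a * b *+ 2) _ Ifg.
have Ic := Z (b ^+ 2) _ g2.
have Iab : mu.-integrable D
    (EFin \o (fun x => a ^+ 2 * f x ^+ 2 + a * b *+ 2 * (f x * g x))).
  rewrite (_ : _ \o _ = (EFin \o (fun x => a ^+ 2 * f x ^+ 2)%R) \+
    (EFin \o (fun x => a * b *+ 2 * (f x * g x))%R))%E//.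
  exact: integrableD.
rewrite -(RintegralZl _ mD f2) -(RintegralZl _ mD Ifg) -(RintegralZl _ mD g2).
rewrite -(RintegralD mD Ia Ib) -(RintegralD mD Iab Ic).
by apply: eq_Rintegral => x _; ring.
Qed.

(** The Cauchy-Schwarz inequality, by nonnegativity of the quadratic form
    (a, b) |-> |a f + b g|^2. *)
Lemma sqr_Rintegral_mul f g : sq_integrable f -> sq_integrable g ->
  (\int[mu]_(x in D) (f x * g x)) ^+ 2 <=
  \int[mu]_(x in D) f x ^+ 2 * \int[mu]_(x in D) g x ^+ 2.
Proof.
move=> If Ig; set P := \int[mu]_(x in D) f x ^+ 2.
set Q := \int[mu]_(x in D) (f x * g x); set S := \int[mu]_(x in D) g x ^+ 2.
have H a b : 0 <= a ^+ 2 * P + a * b *+ 2 * Q + b ^+ 2 * S.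
  rewrite -Rintegral_sqrDZ//; apply: Rintegral_ge0 => x _; exact: sqr_ge0.
have P0 : 0 <= P by apply: Rintegral_ge0 => x _; exact: sqr_ge0.
have S0 : 0 <= S by apply: Rintegral_ge0 => x _; exact: sqr_ge0.
have [S0'|Sn0] := eqVneq S 0.
  rewrite S0' mulr0; have [->|Qn0] := eqVneq Q 0; first by rewrite expr0n.
  (* if S = 0 and Q <> 0 the form would take the value - P - 2 *)
  have := H 1 (- (P + 1) / Q).
  have -> : 1 ^+ 2 * P + 1 * (- (P + 1) / Q) *+ 2 * Q + (- (P + 1) / Q) ^+ 2 * S
    = P - (P + 1) *+ 2 by rewrite S0'; field.
  lra.
have Sp : 0 < S by rewrite lt_neqAle eq_sym Sn0.
have := H S (- Q).
have -> : S ^+ 2 * P + S * - Q *+ 2 * Q + (- Q) ^+ 2 * S = S * (P * S - Q ^+ 2) by ring.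
by rewrite pmulr_rge0// subr_ge0.
Qed.

Lemma Rintegral_sqr_diff f g : sq_integrable f -> sq_integrable g ->
  \int[mu]_(x in D) (f x * (f x - g x)) - \int[mu]_(x in D) (g x * (f x - g x)) =
  \int[mu]_(x in D) (f x - g x) ^+ 2.
Proof.
move=> If Ig; have Ifg : sq_integrable (fun x => f x - g x).
  have := sq_integrableDZ 1 (-1) If Ig.
  by under eq_fun do rewrite mul1r mulN1r.
rewrite -RintegralB//; [|exact: sq_integrable_mul..].
by apply: eq_Rintegral => x _; ring.
Qed.

(** Cauchy-Schwarz for |f|^2 - |g|^2 = (f - g, f + g). *)
Lemma sqr_diff_Rintegral_sqr f g : sq_integrable f -> sq_integrable g ->
  \int[mu]_(x in D) g x ^+ 2 <= \int[mu]_(x in D) f x ^+ 2 ->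
  (\int[mu]_(x in D) f x ^+ 2 - \int[mu]_(x in D) g x ^+ 2) ^+ 2 <=
  4 * \int[mu]_(x in D) f x ^+ 2 * \int[mu]_(x in D) (f x - g x) ^+ 2.
Proof.
move=> If Ig gf.
have Im : sq_integrable (fun x => 1 * f x + (-1) * g x) by exact: sq_integrableDZ.
have Ip : sq_integrable (fun x => 1 * f x + 1 * g x) by exact: sq_integrableDZ.
have -> : \int[mu]_(x in D) f x ^+ 2 - \int[mu]_(x in D) g x ^+ 2 =
  \int[mu]_(x in D) ((1 * f x + (-1) * g x) * (1 * f x + 1 * g x)).
  rewrite -RintegralB//; [|exact: If.2|exact: Ig.2].
  by apply: eq_Rintegral => x _; ring.
apply: le_trans (sqr_Rintegral_mul Im Ip) _.
have -> : \int[mu]_(x in D) (f x - g x) ^+ 2 =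
  \int[mu]_(x in D) (1 * f x + -1 * g x) ^+ 2.
  by apply: eq_Rintegral => x _; ring.
rewrite mulrC ler_wpM2r//; first by apply: Rintegral_ge0 => x _; exact: sqr_ge0.
have := Rintegral_sqrDZ 1 1 If Ig; have := Rintegral_sqrDZ 1 (-1) If Ig.
have : 0 <= \int[mu]_(x in D) (1 * f x + -1 * g x) ^+ 2.
  by apply: Rintegral_ge0 => x _; exact: sqr_ge0.
lra.
Qed.

(** Young's inequality |(f, w)| <= l / 2 |f|^2 + |w|^2 / (2 l), in which the
    norm of f may be infinite. *)
Lemma le_normr_Rintegral_mul (l : R) f w : 0 < l ->
  measurable_fun D f -> sq_integrable w ->
  ((`|\int[mu]_(x in D) (f x * w x)|)%:E <=
   (l / 2)%:E * \int[mu]_(x in D) (f x ^+ 2)%:E +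
   ((l *+ 2)^-1 * \int[mu]_(x in D) w x ^+ 2)%:E)%E.
Proof.
move=> l0 mf [mw w2].
have -> : ((l *+ 2)^-1 * \int[mu]_(x in D) w x ^+ 2)%:E =
    ((l *+ 2)^-1%:E * \int[mu]_(x in D) (w x ^+ 2)%:E)%E.
  by rewrite EFinM /Rintegral fineK//; exact: integrable_fin_num w2.
have li : 0 <= (l *+ 2)^-1 by rewrite invr_ge0 mulrn_wge0// ltW.
have m2 (h : T -> R) : measurable_fun D h -> measurable_fun D (fun x => (h x ^+ 2)%:E).
  by move=> mh; apply/measurable_EFinP; exact: measurable_funX.
have Z (c : R) (h : T -> R) : 0 <= c -> measurable_fun D h ->
    (c%:E * \int[mu]_(x in D) (h x ^+ 2)%:E = \int[mu]_(x in D) (c * h x ^+ 2)%:E)%E.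
  move=> c0 mh; under [RHS]eq_integral do rewrite EFinM.
  by rewrite ge0_integralZl ?lee_fin//; [exact: m2|move=> x _; rewrite lee_fin sqr_ge0].
have l20 : 0 <= l / 2 by rewrite divr_ge0// ltW.
rewrite Z// Z// -ge0_integralD//; first last.
- by apply/measurable_EFinP; apply: measurable_funM => //; exact: measurable_funX.
- by move=> x _; rewrite lee_fin mulr_ge0// sqr_ge0.
- by apply/measurable_EFinP; apply: measurable_funM => //; exact: measurable_funX.
- by move=> x _; rewrite lee_fin mulr_ge0// sqr_ge0.
apply: le_normr_Rintegral => x Dx.
rewrite -EFinD lee_fin normrM.
rewrite -(real_normK (num_real (f x))) -(real_normK (num_real (w x))).
set a := `|f x|; set b := `|w x|.
rewrite -subr_ge0.
have -> : l / 2 * a ^+ 2 + (l *+ 2)^-1 * b ^+ 2 - a * b =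
  (l *+ 2)^-1 * (l * a - b) ^+ 2 by field; rewrite gt_eqF.
by rewrite mulr_ge0// sqr_ge0.
Qed.

End square_integrable.

(** * Lebesgue spaces on row vectors *)

(** An open set is the union of the boxes with rational centre and radius that
    it contains. *)
Lemma open_measurable_rV (R : realType) (n : nat) (D : set 'rV[R]_n) :
  open D -> measurable D.
Proof.
move=> oD.
pose box (p : 'rV[rat]_n * rat) : set 'rV[R]_n := [set x | forall i,
  (ball (ratr (p.1 ord0 i) : R) (ratr p.2 : R)) (rV_coord i x)].
have mbox p : measurable (box p).
  pose A (i : 'I_n) : set (measurableTypeR R) := ball (ratr (p.1 ord0 i) : R) (ratr p.2).
  have mA i : measurable (A i) by exact: measurable_ball.
  by have [] := rV_lebesgue_box mA.
have -> : D = \bigcup_p (if `[< box p `<=` D >] then box p else set0).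
  apply/seteqP; split => x; last by move=> [p _]; case: asboolP => // h /h.
  move=> Dx; have : nbhs x D by exact: open_nbhs_nbhs.
  move=> /nbhs_ballP[e /= e0 eD].
  have [r] : exists r : rat, ratr r \in `](0 : R), e / 2[.
    by apply: rat_in_itvoo; rewrite divr_gt0.
  rewrite in_itv/= => /andP[r0 re].
  have Hc (i : 'I_n) : exists c : rat, `|x ord0 i - ratr c| < ratr r.
    have [c] : exists c : rat, ratr c \in `](x ord0 i - ratr r : R), (x ord0 i + ratr r)[.
      by apply: rat_in_itvoo; lra.
    by rewrite in_itv/= => h; exists c; rewrite ltr_distlC.
  pose c : 'rV[rat]_n := \row_i sval (cid (Hc i)).
  have cx i : `|x ord0 i - ratr (c ord0 i)| < ratr r by rewrite mxE; exact: svalP (cid (Hc i)).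
  exists (c, r) => //; rewrite asboolT; last first.
    move=> y /= yc; apply: eD; split=> // i j; rewrite (ord1 i).
    have h1 := cx j; have h2 := yc j; rewrite /ball/= /rV_coord in h2.
    rewrite /ball/= (le_lt_trans (ler_distD (ratr (c ord0 j)) _ _))//; lra.
  by move=> i; rewrite /ball/= distrC; exact: cx.
apply: countable_bigcupT_measurable => [|p]; first exact: countableP.
by case: ifP.
Qed.

Section Lp_norm.
Context {R : realType} {d : nat}.
Local Notation mu := (rV_lebesgue R d).
Implicit Types (D : set 'rV[R]_d) (w : 'rV[R]_d -> R).

Lemma Lp_norm_poweR D (r : R) w : r != 0 ->
  ((Lp_norm D r%:E w) `^ r)%E = (\int[mu]_(x in D) (`|w x| `^ r)%:E)%E.
Proof.
move=> r0; rewrite (poweR_Lnorm _ _ r0).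
rewrite [RHS]integral_mkcond.
apply: eq_integral => x _; rewrite /= !patchE; case: ifPn => //= _.
by rewrite normr0 powR0.
Qed.

Lemma in_Lp_integrable D (r : R) w : measurable D -> 0 < r ->
  in_Lp D r%:E w -> mu.-integrable D (EFin \o (fun x => `|w x| `^ r)).
Proof.
move=> mD r0 [mw wr]; apply/integrableP; split.
  apply/measurable_EFinP; apply: (measurableT_comp (measurable_powR r)).
  exact: measurableT_comp.
under eq_integral do rewrite /= ger0_norm ?powR_ge0//.
by rewrite -Lp_norm_poweR ?gt_eqF// poweR_lty.
Qed.

Lemma Lp_normR_powR D (r : R) w : 0 < r -> in_Lp D r%:E w ->
  Lp_normR D r%:E w `^ r = \int[mu]_(x in D) (`|w x| `^ r).
Proof.
move=> r0 [mw wr]; rewrite /Rintegral -Lp_norm_poweR ?gt_eqF// /Lp_normR.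
have : Lp_norm D r%:E w \is a fin_num by rewrite ge0_fin_numE// Lnorm_ge0.
by move=> /fineK <-; rewrite poweR_EFin.
Qed.

Lemma Lp_normR_eq0 D (r : R) w : measurable D -> 0 < r -> in_Lp D r%:E w ->
  ae_zero_off D w -> Lp_normR D r%:E w = 0 -> ae_zero w.
Proof.
move=> mD r0 [mw wr] off N0.
have fN : Lp_norm D r%:E w \is a fin_num by rewrite ge0_fin_numE// Lnorm_ge0.
have {}N0 : Lp_norm D r%:E w = 0%E by rewrite -(fineK fN) -/(Lp_normR _ _ _) N0.
have mwD : measurable_fun setT (EFin \o (w \_ D)).
  by apply/measurable_EFinP; apply/(measurable_restrictT _ mD).
have r0' : (0 < r%:E)%E by rewrite lte_fin.
have := Lnorm_eq0_eq0 mwD r0' N0.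
rewrite /ae_zero; apply: filterS2 off => x h1 /(_ I) [].
rewrite patchE; case: ifPn => //; rewrite notin_setE => h _; exact: h1.
Qed.

(** The identity needs no measurability of w. *)
Lemma Lp_norm2_sqr D w :
  (Lp_norm D 2%:E w ^+ 2)%E = (\int[mu]_(x in D) (w x ^+ 2)%:E)%E.
Proof.
have := @Lp_norm_poweR D 2 w; rewrite pnatr_eq0 => /(_ isT).
have -> : ((Lp_norm D 2%:E w) `^ 2)%E = (Lp_norm D 2%:E w ^+ 2)%E.
  have : (0 <= Lp_norm D 2%:E w)%E by exact: Lnorm_ge0.
  case: (Lp_norm D 2%:E w) => [x| |]//=; rewrite ?pnatr_eq0//= ?lee_fin => x0.
  by rewrite powR_mulrn.
move=> ->.
by apply: eq_integral => x _; rewrite powR_mulrn// real_normK// num_real.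
Qed.

Lemma integral_mul_le_Lp_norm D (p q : R) (f g : 'rV[R]_d -> R) : measurable D ->
  measurable_fun D f -> measurable_fun D g -> 0 < p -> 0 < q ->
  p^-1 + q^-1 = 1 ->
  (\int[mu]_(x in D) (`|f x * g x|)%:E <= Lp_norm D p%:E f * Lp_norm D q%:E g)%E.
Proof.
move=> mD mf mg p0 q0 pq.
have mfD : measurable_fun setT (f \_ D) by apply/(measurable_restrictT _ mD).
have mgD : measurable_fun setT (g \_ D) by apply/(measurable_restrictT _ mD).
apply: le_trans (hoelder mu mfD mgD p0 q0 pq); rewrite Lnorm1 [leLHS]integral_mkcond.
rewrite le_eqVlt; apply/orP; left; apply/eqP. apply: eq_integral => x _.
by rewrite /= !patchE; case: ifPn => //; rewrite mul0r normr0.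
Qed.

End Lp_norm.

(** * Energy solutions *)

Lemma measurable_spow (R : realType) (r : R) : measurable_fun setT (spow r).
Proof.
apply: measurable_funM => //.
exact: (measurableT_comp (measurable_powR r)).
Qed.

Lemma spow_half_sqr (R : realType) (q x : R) : 1 < q ->
  spow ((q - 2) / 2) x ^+ 2 = `|x| `^ q.
Proof.
move=> q1; have [->|x0] := eqVneq x 0.
  by rewrite spow0 expr0n normr0 powR0// gt_eqF//; lra.
rewrite /spow exprMn expr2 -powRD ?normr_eq0 ?x0 ?implybT// -splitr.
rewrite -(real_normK (num_real x)) -powR_mulrn// -powRD ?normr_eq0 ?x0 ?implybT//.
by rewrite subrK.
Qed.

(** In this section v = |u|^((q-2)/2) u, F is the q-th power of the L^q norm of
    u, which is also the squared L^2 norm of v, and X is the square of the norm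
    of u in the energy space. *)
Section energy.
Context (R : realType) (d : nat) (D : set 'rV[R]_d) (th q : R).
Variables (u0 : 'rV[R]_d -> R) (u : R -> 'rV[R]_d -> R).
Hypotheses (mD : measurable D) (q1 : 1 < q) (es : energy_solution D th q u0 u).
Local Notation mu := (rV_lebesgue R d).
Local Notation leb := (@lebesgue_measure R).
Local Notation v := (fun t => spow ((q - 2) / 2) \o u t).
Local Notation F := (fun t => Lp_normR D q%:E (u t) `^ q).
Local Notation X := (fun t => X_norm D th (u t) ^+ 2).

Let q0 : 0 < q. Proof. exact: lt_trans ltr01 q1. Qed.

Let qm1 : 0 < q - 1. Proof. by rewrite subr_gt0. Qed.

Let mu_t t : 0 <= t -> measurable_fun D (u t).
Proof. by move=> t0; have [[mu_ _ _] _] := es_space es t0; exact: measurable_funTS. Qed.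

Let mspow r t : 0 <= t -> measurable_fun D (spow r \o u t).
Proof. by move=> t0; apply: measurableT_comp (mu_t t0) => //; exact: measurable_spow. Qed.

Lemma sq_integrable_v t : 0 <= t -> sq_integrable mu D (v t).
Proof.
move=> t0; split; first exact: mspow.
have [_ uq] := es_space es t0.
have := in_Lp_integrable mD q0 uq; congr (integrable _ _ _).
by apply/funext => x /=; rewrite spow_half_sqr.
Qed.

Lemma Rintegral_v_sqr t : 0 <= t -> \int[mu]_(x in D) (v t x ^+ 2) = F t.
Proof.
move=> t0; have [_ uq] := es_space es t0; rewrite Lp_normR_powR//.
by apply: eq_Rintegral => x _ /=; rewrite spow_half_sqr.
Qed.

Let qq1 : q^-1 + (q / (q - 1))^-1 = 1.
Proof. by field; rewrite !gt_eqF. Qed.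

Let qconj : hoelder_conjugate q%:E = (q / (q - 1))%:E :> \bar R.
Proof. 
by rewrite /hoelder_conjugate /= eqe gt_eqF// -EFinB inver gt_eqF.
Qed.

(** v is weakly continuous in L^2(D) up to time 0: the pointwise inequality
    spow_diff_sqr and Hoelder's inequality bound |v s - v t|_2^2 by
    |u s - u t|_q times |rho s - rho t|_q', rho = |u|^(q-2) u, and both factors
    tend to 0. *)
Lemma continuous_v_weak w : sq_integrable mu D w ->
  {within `[0, +oo[, continuous (fun t => \int[mu]_(x in D) (v t x * w x))}.
Proof.
move=> Iw; apply/subspace_continuousP => t; rewrite /= in_itv/= andbT => t0.
have [C C0 HC] := spow_diff_sqr q1.
pose N1 s := Lp_norm D q%:E (u s \- u t).
pose N2 s := Lp_norm D (q / (q - 1))%:E ((spow (q - 2) \o u s) \- (spow (q - 2) \o u t)).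
have cN : (N1 s * N2 s)%E @[s --> within `[0, +oo[ (nbhs t)] --> 0%E.
  have It : (`[0, +oo[ : set R)%classic t by rewrite /= in_itv/= andbT.
  have h1 := es_Lq_cont es It; have h2 := (es_rho_cont es).2 t It.
  rewrite qconj in h2; rewrite -(mule0 0%E).
  by apply: cvgeM h1 h2.
have W0 : 0 <= \int[mu]_(x in D) w x ^+ 2.
  by apply: Rintegral_ge0 => x _; exact: sqr_ge0.
set W := Rintegral mu D _ in W0.
have key s : 0 <= s ->
  (((\int[mu]_(x in D) (v t x * w x) - \int[mu]_(x in D) (v s x * w x)) ^+ 2)%:E <=
   (C * W)%:E * (N1 s * N2 s))%E.
  move=> s0.
  have Is := sq_integrable_v s0; have It := sq_integrable_v t0.
  have Ist : sq_integrable mu D (fun x => v t x - v s x).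
    have := sq_integrableDZ mD 1 (-1) It Is.
    by under eq_fun do rewrite mul1r mulN1r.
  have -> : \int[mu]_(x in D) (v t x * w x) - \int[mu]_(x in D) (v s x * w x) =
    \int[mu]_(x in D) ((v t x - v s x) * w x).
    have I1 := sq_integrable_mul mD It Iw; have I2 := sq_integrable_mul mD Is Iw.
    rewrite -(RintegralB mD I1 I2).
    by apply: eq_Rintegral => x _; exact: (esym (mulrBl _ _ _)).
  apply: (@le_trans _ _ (\int[mu]_(x in D) (v t x - v s x) ^+ 2 * W)%:E).
    by rewrite lee_fin; exact: sqr_Rintegral_mul.
  rewrite EFinM [(C * W)%R]mulrC [(W * C)%:E]EFinM -muleA muleC lee_wpmul2l ?lee_fin//.
  rewrite /Rintegral fineK; last exact: integrable_fin_num Ist.2.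
  apply: (@le_trans _ _ (C%:E * \int[mu]_(x in D)
     (`|(u s x - u t x) * (spow (q - 2) (u s x) - spow (q - 2) (u t x))|)%:E)%E).
    rewrite -ge0_integralZl ?lee_fin//; last first.
      apply/measurable_EFinP; apply: measurableT_comp => //.
      apply: measurable_funM; first by apply: measurable_funB; exact: mu_t.
      by apply: measurable_funB; exact: (mspow (q - 2)).
    apply: ge0_le_integral_nonmeas => x Dx; first by rewrite lee_fin sqr_ge0.
    rewrite -EFinM lee_fin -sqrrN opprB.
    by apply: le_trans (HC _ _) _; rewrite ler_wpM2l// ler_norm.
  rewrite lee_wpmul2l ?lee_fin//.
  apply: integral_mul_le_Lp_norm => //.
  - by apply: measurable_funB; exact: mu_t.
  - by apply: measurable_funB; exact: mspow.
  - by rewrite divr_gt0.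
apply/cvgrPdist_le => e e0.
have d0 : 0 < e ^+ 2 / (C * W + 1) by rewrite divr_gt0 ?exprn_gt0// ltr_wpDl// mulr_ge0.
have h1 : \forall s \near within `[0, +oo[ (nbhs t),
    (N1 s * N2 s < (e ^+ 2 / (C * W + 1))%:E)%E.
  have /fine_cvgP[fN /cvgr_lt /(_ _ d0) ltN] := cN.
  near=> s; have fs : (N1 s * N2 s)%E \is a fin_num by near: s.
  by rewrite -(fineK fs) lte_fin; near: s.
have h2 : \forall s \near within `[0, +oo[ (nbhs t), 0 <= s.
  rewrite near_withinE; near=> s; by rewrite /= in_itv/= andbT.
near=> s.
have s0 : 0 <= s by near: s.
have N12 : (N1 s * N2 s < (e ^+ 2 / (C * W + 1))%:E)%E by near: s.
rewrite -(@ler_pXn2r _ 2)// ?nnegrE ?(ltW e0)// real_normK ?num_real//.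
rewrite -lee_fin; apply: le_trans (key s s0) _.
apply: (@le_trans _ _ ((C * W)%:E * (e ^+ 2 / (C * W + 1))%:E)%E).
  by rewrite lee_wpmul2l ?lee_fin ?mulr_ge0// ltW.
rewrite -EFinM lee_fin mulrA ler_pdivrMr ?ltr_wpDl ?mulr_ge0//.
by rewrite mulrC ler_wpM2l ?sqr_ge0// lerDl.
Unshelve. all: by end_near. Qed.


Lemma time_slice_measurable (dv : R -> 'rV[R]_d -> R) r :
  meas_xt `]0, +oo[ D dv -> 0 < r -> measurable_fun D (dv r).
Proof.
move=> mdv r0; apply/(measurable_restrictT _ mD).
pose I : set (measurableTypeR R) := `]0, +oo[%classic.
have mI : measurable I by exact: measurable_itv.
have mID : measurable (I `*` D) by exact: measurableX.
have := mdv; rewrite /meas_xt => /(measurable_restrictT _ mID) h.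
have := measurableT_comp h (pair1_measurable (T2 := 'rV[R]_d) (r : measurableTypeR R)).
congr measurable_fun; apply/funext => x; rewrite /= !patchE.
have -> : ((r, x) \in I `*` D) = (x \in D).
  apply/idP/idP; rewrite !inE; first by case.
  by move=> Dx; split=> //; rewrite /I /= in_itv/= r0.
by case: ifP.
Qed.

Lemma measurable_slice_norm (dv : R -> 'rV[R]_d -> R) :
  meas_xt `]0, +oo[ D dv ->
  measurable_fun (`]0, +oo[ : set (measurableTypeR R))
    (fun r => \int[mu]_(x in D) (dv r x ^+ 2)%:E)%E.
Proof.
move=> mdv.
pose I : set (measurableTypeR R) := `]0, +oo[%classic.
have mI : measurable I by exact: measurable_itv.
have mID : measurable (I `*` D) by exact: measurableX.
pose G := (fun z : measurableTypeR R * 'rV[R]_d => (dv z.1 z.2 ^+ 2)%:E) \_ (I `*` D).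
have mG : measurable_fun setT G.
  apply/(measurable_restrictT _ mID)/measurable_EFinP; exact: measurable_funX.
have G0 z : (0 <= G z)%E.
  by rewrite /G patchE; case: ifP => // _; rewrite lee_fin sqr_ge0.
have := measurable_fun_fubini_tonelli_F (m2 := mu) G mG G0.
move=> /(measurable_funS measurableT (@subsetT _ I)).
apply: eq_measurable_fun => r; rewrite inE => Ir.
rewrite /fubini_F [RHS]integral_mkcond; apply: eq_integral => x _.
rewrite /G !patchE; have -> : ((r, x) \in I `*` D) = (x \in D); last by [].
by apply/idP/idP; rewrite !inE; [case|move=> Dx; split].
Qed.

(** The dissipation inequality in terms of increments of v: testing the weak
    derivative of v with w = v t - v s gives
    |v t - v s|^2 <= (t - s) times the integral of |v'|^2 over ]s, t[. *)
Lemma dissipation_increment s t : 0 <= s -> s < t ->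
  8 / (q * (q / (q - 1))) * \int[mu]_(x in D) (v t x - v s x) ^+ 2 <=
  (t - s) * (X s - X t).
Proof.
move=> s0 st; have t0 : 0 <= t by exact: le_trans (ltW st).
have ts0 : 0 < t - s by rewrite subr_gt0.
have [dv [[_ [mdv _] wd] diss]] := es_dissipation es.
have Is := sq_integrable_v s0; have It := sq_integrable_v t0.
pose w x := v t x - v s x.
have Iw : sq_integrable mu D w.
  have := sq_integrableDZ mD 1 (-1) It Is.
  by under eq_fun do rewrite mul1r mulN1r.
set W := Rintegral mu D _.
have W0 : 0 <= W by apply: Rintegral_ge0 => x _; exact: sqr_ge0.
pose A := (\int[leb]_(r in `]s, t[) (Lp_norm D 2%:E (dv r) ^+ 2))%E.
have A0 : (0 <= A)%E by apply: integral_ge0 => r _; rewrite sqre_ge0.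
have c0 : 0 < 4 / (q * (q / (q - 1))) by rewrite divr_gt0 ?mulr_gt0 ?invr_gt0.
have dst := diss s t s0 st.
have Afin : A \is a fin_num.
  rewrite ge0_fin_numE// ltey; apply/eqP => AE.
  by move: dst; rewrite -/A AE gt0_muley ?lte_fin// addye.
have wL2 : in_Lp D 2%:E w.
  split; first exact: Iw.1.
  have : (Lp_norm D 2%:E w ^+ 2 < +oo)%E.
    by rewrite Lp_norm2_sqr -ge0_fin_numE ?integral_ge0//;
      [exact: integrable_fin_num Iw.2|move=> x _; rewrite lee_fin sqr_ge0].
  by rewrite !ltey; apply: contra => /eqP ->.
have cg : {within `[s, t], continuous (fun r => \int[mu]_(x in D) (v r x * w x))}.
  apply: continuous_subspaceW (continuous_v_weak Iw) => r /=.
  by rewrite !in_itv/= andbT => /andP[sr _]; exact: le_trans sr.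
have mst : measurable (`]s, t[%classic : set (measurableTypeR R)).
  exact: measurable_itv.
have msl : measurable_fun (`]s, t[%classic : set (measurableTypeR R))
    (fun r => \int[mu]_(x in D) (dv r x ^+ 2)%:E)%E.
  apply: measurable_funS (measurable_slice_norm mdv); first exact: measurable_itv.
  by move=> r /=; rewrite !in_itv/= andbT => /andP[sr _]; exact: le_lt_trans sr.
have sl0 r : (0 <= \int[mu]_(x in D) (dv r x ^+ 2)%:E)%E.
  by apply: integral_ge0 => x _; rewrite lee_fin sqr_ge0.
have ts2 : 0 <= (t - s) / 2 by rewrite divr_ge0// ltW.
have ml : (((t - s) / 2)%:E * A = \int[leb]_(r in `]s, t[)
   (((t - s) / 2)%:E * \int[mu]_(x in D) (dv r x ^+ 2)%:E))%E.
  rewrite ge0_integralZl ?lee_fin//.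
  by congr (_ * _)%E; apply: eq_integral => r _; rewrite Lp_norm2_sqr.
(* Young's inequality with the parameter l = t - s *)
have Wle : (W%:E <= ((t - s) / 2)%:E * A + (W / 2)%:E)%E.
  have := weak_deriv_le_increment (wd _ wL2) s0 st cg
    (b := fun r => ((t - s) / 2)%:E * \int[mu]_(x in D) (dv r x ^+ 2)%:E +
      (((t - s) *+ 2)^-1 * W)%:E)%E.
  rewrite Rintegral_sqr_diff// => /(_ _)/le_trans; apply.
    move=> r /andP[sr rt]; apply: le_normr_Rintegral_mul => //.
    by apply: time_slice_measurable => //; exact: le_lt_trans sr.
  have k0 : 0 <= ((t - s) *+ 2)^-1 * W.
    by rewrite mulr_ge0// invr_ge0 mulrn_wge0// ltW.
  have mf1 : measurable_fun (`]s, t[%classic : set (measurableTypeR R))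
      (fun r => ((t - s) / 2)%:E * \int[mu]_(x in D) (dv r x ^+ 2)%:E)%E.
    by apply: measurable_funeM; exact: msl.
  have mf2 : measurable_fun (`]s, t[%classic : set (measurableTypeR R))
      (fun=> (((t - s) *+ 2)^-1 * W)%:E) by exact: measurable_cst.
  rewrite (ge0_integralD leb mst _ mf1 _ mf2); last 2 first.
  - by move=> r _; rewrite mule_ge0.
  - by move=> r _; rewrite lee_fin.
  have lst : leb `]s, t[%classic = (t - s)%:E.
    by rewrite lebesgue_measure_itv/= lte_fin st -EFinD.
  rewrite -ml leeD2l// integral_cst// [X in (_ * X)%E]lst -EFinM.
  rewrite lee_fin le_eqVlt; apply/orP; left; apply/eqP.
  by field; rewrite gt_eqF.
have {}Wle : W <= (t - s) * fine A.
  move: Wle; rewrite -(fineK Afin) -EFinM -EFinD lee_fin; lra.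
move: dst; rewrite -/A -(fineK Afin) -EFinM -EFinD lee_fin => dst.
apply: (@le_trans _ _ (8 / (q * (q / (q - 1))) * ((t - s) * fine A))).
  by rewrite ler_wpM2l// ltW// divr_gt0 ?mulr_gt0 ?invr_gt0.
rewrite mulrCA ler_wpM2l ?(ltW ts0)//; lra.
Qed.

End energy.

(** * The Rayleigh quotient *)

Lemma abs_continuous_le_deriv (R : realType) (I : set R) (F : R -> R)
    (m a b : R) :
  abs_continuous_on I F -> (forall x, a <= x <= b -> I x) -> a <= b ->
  {ae lebesgue_measure, forall x, a < x < b ->
     derivable F x 1 /\ derive1 F x <= m} ->
  F b - F a <= m * (b - a).
Proof.
move=> acF HI ab Fm.
have acN : abs_continuous_on I (- F).
  move=> e e0; have [dl dl0 H] := acF e e0; exists dl => // k x y xy tr sm.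
  have := H k x y xy tr sm; congr (_ < _); apply: eq_bigr => i _.
  have NF z : (- F) z = - F z by [].
  by rewrite !NF opprK distrC addrC.
have := abs_continuous_ge_deriv (m := - m) acN HI ab.
suff h : {ae lebesgue_measure, forall x, a < x < b ->
     derivable (- F) x 1 /\ - m <= derive1 (- F) x}.
  by move=> /(_ h); rewrite -[(- F) b]/(- F b) -[(- F) a]/(- F a); lra.
apply: (@filterS _ _ (ae_filter_ringOfSetsType lebesgue_measure) _ _ _ Fm) =>
  x /= H /H[dF Fle]; split; first exact: derivableN.
by rewrite derive1E deriveN// lerN2 -derive1E.
Qed.

(** F and X are as in the previous section, and k is the conjugate exponent
    of q. *)
Section rayleigh_quotient.
Context (R : realType) (d : nat) (D : set 'rV[R]_d) (th q : R).
Variables (u0 : 'rV[R]_d -> R) (u : R -> 'rV[R]_d -> R).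
Hypotheses (mD : measurable D) (q1 : 1 < q) (es : energy_solution D th q u0 u).
Local Notation mu := (rV_lebesgue R d).
Local Notation leb := (@lebesgue_measure R).
Local Notation F := (fun t => Lp_normR D q%:E (u t) `^ q).
Local Notation X := (fun t => X_norm D th (u t) ^+ 2).
Local Notation k := (q / (q - 1)).

Let q0 : 0 < q. Proof. exact: lt_trans ltr01 q1. Qed.

Let qm1 : 0 < q - 1. Proof. by rewrite subr_gt0. Qed.

Let k0 : 0 < k. Proof. by rewrite divr_gt0. Qed.

Lemma X_norm_nonincreasing s t : 0 <= s -> s <= t -> X t <= X s.
Proof.
move=> s0; rewrite le_eqVlt => /orP[/eqP -> //|st].
have [dv [_ diss]] := es_dissipation es.
have c0 : 0 <= 4 / (q * k) by rewrite ltW// divr_gt0// mulr_gt0.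
have h : (0 <= (4 / (q * k))%:E *
    \int[leb]_(r in `]s, t[) (Lp_norm D 2%:E (dv r) ^+ 2))%E.
  by rewrite mule_ge0 ?lee_fin// integral_ge0// => r _; rewrite sqre_ge0.
have := le_trans (leeDr (2^-1 * X t)%:E h) (diss s t s0 st).
by rewrite lee_fin ler_pM2l// invr_gt0.
Qed.

(** Bounds on the increments of F, from F' = - k X almost everywhere and the
    monotonicity of X. *)
Lemma Lq_norm_decrease s t : 0 <= s -> s <= t ->
  k * X t * (t - s) <= F s - F t <= k * X s * (t - s).
Proof.
move=> s0 st.
have HI (r : R) : s <= r <= t -> `[0, +oo[%classic r.
  by move=> /andP[sr _]; rewrite /= in_itv/= andbT (le_trans s0).
have Fid := es_Lq_identity es; have acF := es_Lq_abs_cont es.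
have Fd r : 0 < r -> k^-1 * derive1 F r + X r = 0 -> derive1 F r = - (k * X r).
  move=> r0 h; have -> : X r = - (k^-1 * derive1 F r) by rewrite -(subr0 (X r)) -h; ring.
  by rewrite mulrN opprK mulrA divff ?mul1r// gt_eqF.
have h1 : - (k * X s) * (t - s) <= F t - F s.
  apply: (abs_continuous_ge_deriv acF HI st).
  apply: (@filterS _ _ (ae_filter_ringOfSetsType leb) _ _ _ Fid) => r /= H /andP[sr rt].
  have r0 : 0 < r by exact: le_lt_trans sr.
  have [dF /(Fd r r0) ->] := H r0; split=> //.
  by rewrite lerN2 ler_pM2l// X_norm_nonincreasing// ltW.
have h2 : F t - F s <= - (k * X t) * (t - s).
  apply: (abs_continuous_le_deriv acF HI st).
  apply: (@filterS _ _ (ae_filter_ringOfSetsType leb) _ _ _ Fid) => r /= H /andP[sr rt].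
  have r0 : 0 < r by exact: le_lt_trans sr.
  have [dF /(Fd r r0) ->] := H r0; split=> //.
  by rewrite lerN2 ler_pM2l// X_norm_nonincreasing// ltW.
apply/andP; split; lra.
Qed.

(** The increment form of X' <= - (2 / q) k X^2 / F. *)
Lemma X_norm_decrease s t : 0 <= s -> s <= t -> 0 < F t ->
  2 / q * k * X t ^+ 2 * (t - s) / F s <= X s - X t.
Proof.
move=> s0 st Ft.
have [<-|ts] := eqVneq s t; first by rewrite !subrr mulr0 mul0r.
have {ts}st' : s < t by rewrite lt_neqAle ts.
have ts0 : 0 < t - s by rewrite subr_gt0.
have t0 : 0 <= t by exact: le_trans st.
have /andP[F1 _] := Lq_norm_decrease s0 st.
have X0 : 0 <= X t by exact: sqr_ge0.
have Fst0 : 0 <= k * X t * (t - s).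
  by apply: mulr_ge0; [apply: mulr_ge0 => //; exact: ltW|exact: ltW].
have Fts : F t <= F s by rewrite -subr_ge0; exact: le_trans F1.
have Fs : 0 < F s by exact: lt_le_trans Fts.
have := dissipation_increment mD q1 es s0 st'.
set W := Rintegral mu D _ => HW.
have FW : (F s - F t) ^+ 2 <= 4 * F s * W.
  have Is := sq_integrable_v mD q1 es s0; have It := sq_integrable_v mD q1 es t0.
  have := sqr_diff_Rintegral_sqr mD Is It.
  rewrite !(Rintegral_v_sqr q1 es)// => /(_ Fts) h; apply: le_trans h _.
  rewrite le_eqVlt; apply/orP; left; apply/eqP; congr (_ * _).
  by apply: eq_Rintegral => x _; rewrite -sqrrN opprB.
(* the decrease of F = |v|^2 forces v to move *)
have h1 : (k * X t * (t - s)) ^+ 2 <= 4 * F s * W.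
  by apply: le_trans FW; rewrite lerXn2r ?nnegrE//; exact: le_trans F1.
have c0 : 0 < 8 / (q * k) by rewrite divr_gt0// mulr_gt0.
have h2 : 8 / (q * k) * ((k * X t * (t - s)) ^+ 2 / (4 * F s)) <=
    (t - s) * (X s - X t).
  apply: le_trans HW; rewrite ler_pM2l// ler_pdivrMr ?mulr_gt0//.
  by rewrite [leRHS]mulrC.
rewrite -(ler_pM2l ts0); apply: le_trans h2.
rewrite le_eqVlt; apply/orP; left; apply/eqP.
by field; rewrite !gt_eqF.
Qed.

Lemma rayleigh_nonincreasing s t : 0 <= s -> s <= t -> ~ ae_zero (u t) ->
  rayleigh D th q (u t) <= rayleigh D th q (u s).
Proof.
move=> s0 st ut; have t0 : 0 <= t by exact: le_trans st.
have rayE r : 0 <= r -> rayleigh D th q (u r) = X r / F r `^ (2 / q).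
  move=> r0; rewrite /rayleigh -powRrM mulrCA divff ?gt_eqF// mulr1.
  by rewrite powR_mulrn// fine_ge0// Lnorm_ge0.
have [[_ off _] uq] := es_space es t0.
have Ft : 0 < F t.
  rewrite lt_neqAle powR_ge0 andbT eq_sym; apply/eqP => /powR_eq0_eq0 N0.
  by apply: ut; exact: Lp_normR_eq0 uq off N0.
(* where X vanishes the quotient is 0, the least possible value *)
have [Xt|Xt] := eqVneq (X t) 0.
  rewrite (rayE t t0) (rayE s s0).
  rewrite [leLHS](_ : _ = 0); last by rewrite Xt mul0r.
  by apply: divr_ge0; [exact: sqr_ge0|exact: powR_ge0].
have {}Xt : 0 < X t by rewrite lt_neqAle eq_sym Xt sqr_ge0.
rewrite (rayE t t0) (rayE s s0); apply: (@quotient_nonincreasing _ X F (2 / q) k) => //.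
- by rewrite divr_gt0.
- by move=> a b sa ab _; apply: X_norm_nonincreasing => //; exact: le_trans sa.
- move=> a b sa ab _; have a0 : 0 <= a by exact: le_trans sa.
  have /andP[h1 ->] := Lq_norm_decrease a0 ab; rewrite andbT; apply: le_trans h1.
  apply: mulr_ge0; last by rewrite subr_ge0.
  by apply: mulr_ge0; [exact: ltW|exact: sqr_ge0].
- by move=> a b sa ab _ _ Fb; apply: X_norm_decrease => //; exact: le_trans sa.
Qed.

End rayleigh_quotient.

Theorem theorem3p6 (R : realType) (d : nat) (Omega : set 'rV[R]_d)
    (q theta : R) (u0 : 'rV[R]_d -> R) (u : R -> 'rV[R]_d -> R) :
  (0 < d)%N ->
  bounded_domain Omega ->
  1 < q ->
  0 < theta <= 1 ->
  in_X Omega theta u0 ->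
  in_Lp Omega q%:E u0 ->
  ~ ae_zero u0 ->
  ((crit_exp d theta < q%:E)%E ->
     in_Lp Omega (hoelder_conjugate (crit_exp d theta))
       (spow (q - 2) \o u0)) ->
  energy_solution Omega theta q u0 u ->
  forall s t : R, 0 <= s -> s <= t ->
    ~ ae_zero (u s) -> ~ ae_zero (u t) ->
    rayleigh Omega theta q (u t) <= rayleigh Omega theta q (u s).
Proof.
move=> _ [oD _ _ _] q1 _ _ _ _ _ es s t s0 st _ ut.
have mD : measurable Omega by exact: open_measurable_rV.
exact (rayleigh_nonincreasing mD q1 es s0 st ut).
Qed.
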